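(* Let $(G,E)$ be a level transitive self-similar groupoid action, where $E$ is a finite directed graph with no sources and $G$ is a discrete groupoid with unit space $G^{(0)}=E^0$. Suppose there is an integer $p\ge 2$ such that $|uE^1|=p$ for all $u\in E^0$, and let $\nu$ be the uniform probability measure on $X=E^\infty$. Then the $C^*$-algebra $C^*(\kappa)$ of the Koopman representation $\kappa$ of $G$ on $L^2(X,\nu)$ is residually finite-dimensional and it has a normalized trace $\tau_0$.
   Context: Graphs. $E=(E^0,E^1,r,s)$ is a finite directed graph with no sources, meaning that $vE^1:=\{e\in E^1: r(e)=v\}$ is nonempty for every $v\in E^0$. For $k\ge 2$, $E^k=\{e_1e_2\cdots e_k: e_i\in E^1,\ r(e_{i+1})=s(e_i)\}$ is the set of paths of length $k$, with $r(e_1\cdots e_k)=r(e_1)$ and $s(e_1\cdots e_k)=s(e_k)$; vertices are paths of length $0$. $E^*=\bigcup_{k\ge 0}E^k$ is the set of finite paths, and $E^\infty$ is the space of infinite paths $e_1e_2\cdots$ (with $r(e_{i+1})=s(e_i)$ for all $i$ and range $r(e_1)$), with the topology generated by the cylinder sets $Z(\alpha)=\{\alpha\xi:\xi\in E^\infty\}$, $\alpha\in E^*$ (where $\alpha\xi$ is defined when $r(\xi)=s(\alpha)$). For $v\in E^0$, $vE^k$, $vE^*$, $vE^\infty$ denote the paths with range $v$. Partial isomorphisms. A partial isomorphism is a pair $(v,w)\in E^0\times E^0$ together with a bijection $g:vE^*\to wE^*$ which restricts to bijections $vE^k\to wE^k$ for all $k\ge 1$ and satisfies $g(\xi e)\in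 g(\xi)E^1$ for all $\xi\in vE^*$ and $e\in E^1$ with $r(e)=s(\xi)$. Under composition these form a discrete groupoid $\mathrm{PIso}(T_E)$ with unit space $E^0$ ($v$ is identified with $\mathrm{id}_{vE^*}$); a bijection $g: vE^*\to wE^*$ has domain $d(g)=v$ and target $t(g)=w$. Self-similar actions. Let $G$ be a discrete groupoid with unit space $G^{(0)}=E^0$, with domain and target maps $d,t$. A self-similar action $(G,E)$ is a faithful (injective) groupoid homomorphism $G\to\mathrm{PIso}(T_E)$, identity on units (write $g\cdot\xi$ for the resulting action, $g\in G$, $\xi\in d(g)E^*$), such that for every $g\in G$ and $e\in d(g)E^1$ there is a unique $h\in G$, denoted $g|_e$, with $g\cdot(e\xi)=(g\cdot e)(h\cdot\xi)$ for all $\xi\in s(e)E^*$. It induces an action on $E^\infty$: for $\xi\in d(g)E^\infty$, $g\cdot\xi=\eta$ where $g\cdot(\xi_1\cdots\xi_n)=\eta_1\cdots\eta_n$ for all $n$. The action is level transitive if for every $n$ the induced action on $E^n$ is transitive: for all $\alpha,\beta\in E^n$ there is $g\in G$ with $d(g)=r(\alpha)$ and $g\cdot\alpha=\beta$. Measure. When $|uE^1|=p$ for all $u\in E^0$, the uniform probability measure $\nu$ on $E^\infty$ is the Borel probability measure with $\nu(Z(\alpha))=\frac{1}{|E^0|p^n}$ for $\alpha\in E^n$, $n\ge 0$ (so $\nu(uE^\infty)=1/|E^0|$). It is $G$-invariant, i.e. $\nu(g^{-1}\cdot A)=\nu(A)$ for $g\in G$ and Borel $A\subseteq t(g)E^\infty$.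 Koopman representation. For $g\in G$, $\kappa_g:L^2(d(g)E^\infty,\nu)\to L^2(t(g)E^\infty,\nu)$ is given by $\kappa_g(f)(x)=f(g^{-1}\cdot x)$; it is regarded as a partial isometry on $L^2(E^\infty,\nu)=\bigoplus_{u\in E^0}L^2(uE^\infty,\nu)$ by extending it by $0$ on the other summands. $C_c(G)$ is the convolution $*$-algebra of finitely supported functions $G\to\mathbb{C}$, and $\kappa$ extends to it by $\kappa(f)=\sum_{g}f(g)\kappa_g$. $C^*(\kappa)$ is the operator norm closure of $\kappa(C_c(G))$ in the algebra of bounded operators on $L^2(E^\infty,\nu)$. A $C^*$-algebra $A$ is residually finite-dimensional if there are $*$-homomorphisms $\pi_n:A\to M_{k(n)}(\mathbb{C})$, $n\ge 1$, into matrix algebras which determine an injective map $A\to\prod_{n\ge1}M_{k(n)}(\mathbb{C})$. A trace on a $C^*$-algebra $A$ is a linear functional $\tau:A\to\mathbb{C}$ with $\tau(x^*x)\ge 0$ and $\tau(xy)=\tau(yx)$ for all $x,y\in A$; it is normalized if $A$ is unital and $\tau(1)=1$. *)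

(* Defs.v *)
Set Warnings "-notation-overridden,-ambiguous-paths,-notation-incompatible-prefix,-redundant-canonical-projection,-projection-no-head-constant".
From HB Require Import structures.
From mathcomp Require Import all_boot all_order all_algebra.
From mathcomp Require Import all_classical all_reals all_analysis.
From mathcomp Require Import measurable_realfun complex.

Set Implicit Arguments.
Unset Strict Implicit.
Unset Printing Implicit Defensive.

Import Order.TTheory GRing.Theory Num.Theory.
Import numFieldNormedType.Exports.

Local Open Scope classical_set_scope.
Local Open Scope ring_scope.

(* [vert] nonempty is forced as soon as the infinite path space carries a
   probability measure; it is a field because the measurable types of the
   library are pointed. *)
Record graph := Graph {
  vert : finType ;
  edge : finType ;
  rng : edge -> vert ;
  src : edge -> vert ;
  no_sources : forall v, exists e, rng e == v ;
  vert_nonempty : (0 < #|vert|)%N }.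

Section Paths.
Variable E : graph.

(* The path e_1 ... e_k is encoded by (r(e_1), [:: e_1; ...; e_k]) and the
   vertex v by (v, [::]). *)
Definition prepath : Type := (vert E * seq (edge E))%type.

Fixpoint walk (v : vert E) (l : seq (edge E)) : bool :=
  if l is e :: l' then (rng e == v) && walk (src e) l' else true.

Definition prng (a : prepath) : vert E := a.1.
Definition psrc (a : prepath) : vert E := last a.1 (map (@src E) a.2).
Definition plen (a : prepath) : nat := size a.2.

Definition fpaths : set prepath := [set a | walk a.1 a.2].
Definition fpaths_len (n : nat) : set prepath :=
  [set a | fpaths a /\ plen a = n].
Definition fpaths_at (v : vert E) : set prepath :=
  [set a | fpaths a /\ prng a = v].
Definition fpaths_at_len (v : vert E) (n : nat) : set prepath :=
  [set a | fpaths_at v a /\ plen a = n].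

Definition edge_path (e : edge E) : prepath := (rng e, [:: e]).

(* Concatenation ab; it is a path when a and b are and [psrc a = prng b]. *)
Definition pcat (a b : prepath) : prepath := (a.1, a.2 ++ b.2).

Record ipath := IPath {
  ipath_edge :> nat -> edge E ;
  ipathP : forall i, rng (ipath_edge i.+1) = src (ipath_edge i) }.

HB.instance Definition _ := gen_eqMixin ipath.
HB.instance Definition _ := gen_choiceMixin ipath.

Definition edge_into (v : vert E) : edge E := xchoose (no_sources v).

Lemma rng_edge_into v : rng (edge_into v) = v.
Proof. exact/eqP/(xchooseP (no_sources v)). Qed.

Lemma ipath_inhabited : exists x : ipath, True.
Proof.
have /card_gt0P [v0 _] := vert_nonempty E.
pose f := fix f n := if n is n'.+1 then edge_into (src (f n')) else edge_into v0.
by exists (@IPath f (fun i => rng_edge_into _)).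
Qed.

HB.instance Definition _ :=
  isPointed.Build ipath (projT1 (cid ipath_inhabited)).

Definition irng (x : ipath) : vert E := rng (x 0%N).

Definition iprefix (n : nat) (x : ipath) : prepath := (irng x, mkseq x n).

(* Z(a), as the set of infinite paths with initial segment a. *)
Definition cylinder (a : prepath) : set ipath :=
  [set x | iprefix (plen a) x = a].

HB.instance Definition _ := isSubBaseTopological.Build ipath
  [set cylinder a | a in fpaths] id.

Definition borel_ipath := g_sigma_algebraType (@open ipath).

HB.instance Definition _ := Measurable.on borel_ipath.

End Paths.

Arguments fpaths E : clear implicits.
Arguments fpaths_len E n : clear implicits.

(* Values of [gmul] on non composable pairs are irrelevant. *)
Record groupoid (V : Type) := Groupoid {
  arrow :> choiceType ;
  gdom : arrow -> V ;
  gtgt : arrow -> V ;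
  gone : V -> arrow ;
  gmul : arrow -> arrow -> arrow ;
  ginv : arrow -> arrow ;
  gdom_one : forall v, gdom (gone v) = v ;
  gtgt_one : forall v, gtgt (gone v) = v ;
  gdom_mul : forall g h, gdom g = gtgt h -> gdom (gmul g h) = gdom h ;
  gtgt_mul : forall g h, gdom g = gtgt h -> gtgt (gmul g h) = gtgt g ;
  gmulA : forall g h k, gdom g = gtgt h -> gdom h = gtgt k ->
    gmul g (gmul h k) = gmul (gmul g h) k ;
  gmul1g : forall g, gmul (gone (gtgt g)) g = g ;
  gmulg1 : forall g, gmul g (gone (gdom g)) = g ;
  gdom_inv : forall g, gdom (ginv g) = gtgt g ;
  gtgt_inv : forall g, gtgt (ginv g) = gdom g ;
  gmulVg : forall g, gmul (ginv g) g = gone (gdom g) ;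
  gmulgV : forall g, gmul g (ginv g) = gone (gtgt g) }.

Section SelfSimilar.
Variable E : graph.

(* g restricts to a partial isomorphism vE* -> wE*; its values outside vE*
   are irrelevant. *)
Definition piso (v w : vert E) (g : prepath E -> prepath E) : Prop :=
  [/\ set_bij (fpaths_at v) (fpaths_at w) g,
      forall k, (1 <= k)%N ->
        set_bij (fpaths_at_len v k) (fpaths_at_len w k) g &
      forall a e, fpaths_at v a -> rng e = psrc a ->
        exists2 f, rng f = psrc (g a) &
          g (pcat a (edge_path e)) = pcat (g a) (edge_path f)].

Variable G : groupoid (vert E).

(* [act g a] is meaningful for [prng a = gdom g]. *)
Record self_similar (act : G -> prepath E -> prepath E) : Prop := SelfSimilar {
  act_piso : forall g, piso (gdom g) (gtgt g) (act g) ;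
  act_one : forall v a, fpaths_at v a -> act (gone G v) a = a ;
  act_mul : forall g h a, gdom g = gtgt h -> fpaths_at (gdom h) a ->
    act (gmul g h) a = act g (act h a) ;
  act_faithful : forall g h, gdom g = gdom h -> gtgt g = gtgt h ->
    (forall a, fpaths_at (gdom g) a -> act g a = act h a) -> g = h ;
  act_restrict : forall g e, rng e = gdom g ->
    exists! h : G, [/\ gdom h = src e,
      gtgt h = psrc (act g (edge_path e)) &
      forall a, fpaths_at (src e) a ->
        act g (pcat (edge_path e) a) = pcat (act g (edge_path e)) (act h a)] }.

Definition level_transitive (act : G -> prepath E -> prepath E) : Prop :=
  forall n a b, fpaths_len E n a -> fpaths_len E n b ->
    exists2 g, gdom g = prng a & act g a = b.

(* The action on E^oo: g.x is the infinite path y such that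
   g.(x_1 ... x_n) = y_1 ... y_n for all n; the default value x is only used
   for [irng x != gdom g]. *)
Definition iact (act : G -> prepath E -> prepath E) (g : G) (x : ipath E) :
    ipath E :=
  xget x [set y | irng x = gdom g /\
                  forall n, act g (iprefix n x) = iprefix n y].

End SelfSimilar.

Definition uniform_measure (E : graph) (R : realType) (p : nat)
    (nu : probability (borel_ipath E) R) : Prop :=
  forall n a, fpaths_len E n a ->
    nu (cylinder a) = ((#|vert E| * p ^ n)%:R^-1)%:E.

Section L2.
Context d (T : measurableType d) (R : realType).
Variable mu : {measure set T -> \bar R}.

Notation C := R[i].
Notation cabs := ComplexField.Normc.normc.

Definition square_integrable (f : T -> C) : Prop :=
  [/\ measurable_fun setT (fun x => complex.Re (f x)),
      measurable_fun setT (fun x => complex.Im (f x)) &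
      finite_norm mu 2%:E (fun x => cabs (f x))].

Lemma le1_2 : (1 <= 2%:E :> \bar R)%E.
Proof. by rewrite lee_fin ler1n. Qed.

Lemma Re_le_cabs (z : C) : `|complex.Re z| <= cabs z.
Proof.
case: z => a b /=; rewrite -sqrtr_sqr ler_wsqrtr// lerDl sqr_ge0//.
Qed.

Lemma Im_le_cabs (z : C) : `|complex.Im z| <= cabs z.
Proof.
case: z => a b /=; rewrite -sqrtr_sqr ler_wsqrtr// lerDr sqr_ge0//.
Qed.

Lemma cabs_le (z : C) : cabs z <= `|complex.Re z| + `|complex.Im z|.
Proof.
case: z => a b /=; rewrite -(@ler_pXn2r _ 2) ?nnegrE ?sqrtr_ge0 ?addr_ge0//.
rewrite sqr_sqrtr ?addr_ge0 ?sqr_ge0// sqrrD !real_normK ?num_real//.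
by rewrite lerD2r lerDl mulrn_wge0 ?mulr_ge0.
Qed.

Lemma measurable_cabs (f : T -> C) :
  measurable_fun setT (fun x => complex.Re (f x)) ->
  measurable_fun setT (fun x => complex.Im (f x)) ->
  measurable_fun setT (fun x => cabs (f x)).
Proof.
move=> mr mi; rewrite (_ : (fun x => cabs (f x)) =
  @Num.sqrt R \o (fun x => complex.Re (f x) ^+ 2 + complex.Im (f x) ^+ 2)).
  apply: measurableT_comp => //; first exact: (continuous_measurable_fun (@sqrt_continuous R)).
  by apply: measurable_funD; exact: measurable_funX.
by apply/funext => x /=; case: (f x).
Qed.

Lemma finite_norm_le (f g : T -> R) :
  measurable_fun setT f -> measurable_fun setT g ->
  (forall x, `|f x| <= `|g x|) ->
  finite_norm mu 2%:E g -> finite_norm mu 2%:E f.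
Proof.
move=> mf mg fg; rewrite /finite_norm => h; apply: le_lt_trans h; rewrite unlock /=.
have mp (h : T -> R) : measurable_fun setT h ->
    measurable_fun setT (fun x => ((`|h x| `^ 2)%:E : \bar R)).
  move=> mh; apply/measurable_EFinP.
  apply: (@measurableT_comp _ _ _ _ _ _ (@powR R ^~ 2)) => //.
  exact: measurableT_comp.
have ip (h : T -> R) : (0 <= \int[mu]_x (`|h x| `^ 2)%:E)%E.
  by apply: integral_ge0 => x _; rewrite lee_fin powR_ge0.
rewrite gt0_ler_poweR ?in_itv/= ?leey ?ip//.
apply: ge0_le_integral => //.
- exact: mp.
- exact: mp.
- by move=> x _; rewrite lee_fin ge0_ler_powR ?nnegrE//.
Qed.

Lemma square_integrableP (f : T -> C) : square_integrable f <->
  (fun x => complex.Re (f x)) \in Lfun mu 2%:E /\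
  (fun x => complex.Im (f x)) \in Lfun mu 2%:E.
Proof.
have cabs_ge0 (z : C) : 0 <= cabs z by case: z => a b /=; exact: sqrtr_ge0.
split=> [[mr mi fin]|].
  have mc := measurable_cabs mr mi.
  split; rewrite inE; apply/andP; split; rewrite !inE//.
    apply: finite_norm_le fin => // x; rewrite (ger0_norm (cabs_ge0 _)).
    exact: Re_le_cabs.
  apply: finite_norm_le fin => // x; rewrite (ger0_norm (cabs_ge0 _)).
  exact: Im_le_cabs.
move=> [/andP[/[!inE] mr fr] /andP[/[!inE] mi fi]]; split => //.
have mnr : measurable_fun setT (fun x => `|complex.Re (f x)|).
  exact: measurableT_comp.
have mni : measurable_fun setT (fun x => `|complex.Im (f x)|).
  exact: measurableT_comp.
have fnr : finite_norm mu 2%:E (fun x => `|complex.Re (f x)|).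
  by apply: finite_norm_le fr => // x; rewrite normr_id.
have fni : finite_norm mu 2%:E (fun x => `|complex.Im (f x)|).
  by apply: finite_norm_le fi => // x; rewrite normr_id.
apply: (@finite_norm_le _ ((fun x => `|complex.Re (f x)|) \+
                           (fun x => `|complex.Im (f x)|))).
- exact: measurable_cabs.
- exact: measurable_funD.
- move=> x /=; rewrite (ger0_norm (cabs_ge0 _)) [leRHS]ger0_norm ?addr_ge0//.
  exact: cabs_le.
- rewrite /finite_norm; apply: le_lt_trans.
    by apply: (@eminkowski _ _ _ mu _ _ 2%:E) => //; exact: le1_2.
  by rewrite lte_add_pinfty.
Qed.

Definition l2pred : {pred T -> C} := fun f => `[< square_integrable f >].

Lemma l2pred_submod_closed : submod_closed l2pred.
Proof.
have Z (a : R) (f : T -> R) : f \in Lfun mu 2%:E ->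
    (fun x => a * f x) \in Lfun mu 2%:E.
  move=> fL; have [_ /(_ a f 0 fL)] := Lfun_submod_closed mu le1_2.
  by rewrite addr0; apply; have [] := Lfun_submod_closed mu le1_2.
have D (f g : T -> R) : f \in Lfun mu 2%:E -> g \in Lfun mu 2%:E ->
    (fun x => f x + g x) \in Lfun mu 2%:E.
  move=> fL gL; have [_ /(_ 1 f g fL gL)] := Lfun_submod_closed mu le1_2.
  by rewrite scale1r.
split.
  apply/asboolP/square_integrableP.
  have [L0 _] := Lfun_submod_closed mu le1_2.
  by split; exact: L0.
move=> a f g /asboolP/square_integrableP[fr fi].
move=> /asboolP/square_integrableP[gr gi].
apply/asboolP/square_integrableP; case: a => a b; split.
  rewrite (_ : (fun x => _) = (fun x => (a * complex.Re (f x) +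
      (- b) * complex.Im (f x)) + complex.Re (g x))).
    by apply: (D) => //; apply: (D); exact: Z.
  apply/funext => x; rewrite fctE /GRing.scale/=.
  by case: (f x) (g x) => [u v] [u' v'] /=; rewrite mulNr.
rewrite (_ : (fun x => _) = (fun x => (a * complex.Im (f x) +
    b * complex.Re (f x)) + complex.Im (g x))).
  by apply: (D) => //; apply: (D); exact: Z.
apply/funext => x; rewrite fctE /GRing.scale/=.
by case: (f x) (g x) => [u v] [u' v'] /=.
Qed.

HB.instance Definition _ :=
  GRing.isSubmodClosed.Build C (T -> C) l2pred l2pred_submod_closed.

Record l2fun := L2Fun { l2fun_val :> T -> C ; _ : l2fun_val \in l2pred }.

HB.instance Definition _ := [isSub for l2fun_val].
HB.instance Definition _ := [Choice of l2fun by <:].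
HB.instance Definition _ := [SubChoice_isSubLmodule of l2fun by <:].

Lemma l2funD (f g : l2fun) x : (f + g) x = f x + g x. Proof. by []. Qed.
Lemma l2funN (f : l2fun) x : (- f) x = - f x. Proof. by []. Qed.
Lemma l2funZ a (f : l2fun) x : (a *: f) x = a * f x. Proof. by []. Qed.

Definition l2eq (f g : l2fun) : bool := `[< {ae mu, forall x, f x = g x} >].

Lemma l2eq_refl : reflexive l2eq.
Proof. by move=> f; apply/asboolP; apply: nearW. Qed.

Lemma l2eq_sym : symmetric l2eq.
Proof.
by move=> f g; apply/asboolP/asboolP => h; apply: filterS h => x ->.
Qed.

Lemma l2eq_trans : transitive l2eq.
Proof.
move=> g f h /asboolP fg /asboolP gh; apply/asboolP.
by apply: filterS2 fg gh => x -> ->.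
Qed.

Canonical l2eq_equiv := EquivRel l2eq l2eq_refl l2eq_sym l2eq_trans.

Definition L2 : Type := {eq_quot l2eq}%qT.
HB.instance Definition _ := Choice.on L2.
HB.instance Definition _ := EqQuotient.on L2.

Definition L2_fun (F : L2) : T -> C := l2fun_val (repr F).
Coercion L2_fun : L2 >-> Funclass.

Definition L2mk (f : l2fun) : L2 := (\pi_L2 f)%qT.

Lemma L2mkP (f g : l2fun) :
  L2mk f = L2mk g <-> {ae mu, forall x, f x = g x}.
Proof.
rewrite /L2mk; split; first by move=> /eqquotP /asboolP.
by move=> h; apply/eqquotP/asboolP.
Qed.

Lemma L2mkK (F : L2) : L2mk (repr F) = F.
Proof. exact: reprK. Qed.

Lemma repr_L2mk (f : l2fun) : {ae mu, forall x, repr (L2mk f) x = f x}.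
Proof. by apply/L2mkP; rewrite L2mkK. Qed.

Definition L2add (F G : L2) : L2 := L2mk (repr F + repr G).
Definition L2opp (F : L2) : L2 := L2mk (- repr F).
Definition L2zero : L2 := L2mk 0.
Definition L2scale (a : C) (F : L2) : L2 := L2mk (a *: repr F).

Lemma L2mkD f g : L2add (L2mk f) (L2mk g) = L2mk (f + g).
Proof.
apply/L2mkP; apply: filterS2 (repr_L2mk f) (repr_L2mk g) => x.
by rewrite !l2funD => -> ->.
Qed.

Lemma L2mkN f : L2opp (L2mk f) = L2mk (- f).
Proof.
by apply/L2mkP; apply: filterS (repr_L2mk f) => x; rewrite !l2funN => ->.
Qed.

Lemma L2mkZ a f : L2scale a (L2mk f) = L2mk (a *: f).
Proof.
by apply/L2mkP; apply: filterS (repr_L2mk f) => x; rewrite !l2funZ => ->.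
Qed.

Lemma L2addA : associative L2add.
Proof.
move=> F G H; rewrite -(L2mkK F) -(L2mkK G) -(L2mkK H).
by rewrite !L2mkD addrA.
Qed.

Lemma L2addC : commutative L2add.
Proof. by move=> F G; rewrite -(L2mkK F) -(L2mkK G) !L2mkD addrC. Qed.

Lemma L2add0 : left_id L2zero L2add.
Proof. by move=> F; rewrite -(L2mkK F) L2mkD add0r. Qed.

Lemma L2addN : left_inverse L2zero L2opp L2add.
Proof. by move=> F; rewrite -(L2mkK F) L2mkN L2mkD addNr. Qed.

HB.instance Definition _ :=
  GRing.isZmodule.Build L2 L2addA L2addC L2add0 L2addN.

Lemma L2scaleA a b F : L2scale a (L2scale b F) = L2scale (a * b) F.
Proof. by rewrite -(L2mkK F) !L2mkZ scalerA. Qed.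

Lemma L2scale1 : left_id 1 L2scale.
Proof. by move=> F; rewrite -(L2mkK F) L2mkZ scale1r. Qed.

Lemma L2scaleDr : right_distributive L2scale +%R.
Proof.
move=> a F G; rewrite -(L2mkK F) -(L2mkK G).
by rewrite [_ + _]L2mkD !L2mkZ [RHS]L2mkD scalerDr.
Qed.

Lemma L2scaleDl F : {morph L2scale^~ F : a b / a + b}.
Proof. by move=> a b; rewrite -(L2mkK F) !L2mkZ [RHS]L2mkD scalerDl. Qed.

HB.instance Definition _ :=
  GRing.Zmodule_isLmodule.Build C L2 L2scaleA L2scale1 L2scaleDr L2scaleDl.

(* The class of f if f is square integrable, 0 otherwise. *)
Definition L2class (f : T -> C) : L2 := L2mk (insubd (0 : l2fun) f).

Lemma L2classE (f : T -> C) :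
  square_integrable f -> {ae mu, forall x, L2class f x = f x}.
Proof.
move=> sf; have fl2 : f \in l2pred by exact/asboolP.
have vf : l2fun_val (insubd (0 : l2fun) f) = f by exact: insubdK.
by apply: filterS (repr_L2mk (insubd 0 f)) => x; rewrite [X in _ = X]/= vf.
Qed.

Definition Cintegral (f : T -> C) : C :=
  Complex (\int[mu]_x complex.Re (f x)) (\int[mu]_x complex.Im (f x)).

Definition l2inner (F G : L2) : C := Cintegral (fun x => F x * conjc (G x)).

Definition l2norm (F : L2) : R :=
  fine ('N[mu]_2%:E [EFin \o (fun x => cabs (F x))])%E.

Implicit Types A : set (L2 -> L2).

Definition bounded_operator (U : L2 -> L2) : Prop :=
  linear U /\ exists c : R, forall F, l2norm (U F) <= c * l2norm F.

Definition opnorm (U : L2 -> L2) : R :=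
  sup [set l2norm (U F) | F in [set F | l2norm F <= 1]].

(* For a bounded operator U the set below is a singleton, by the Riesz
   representation theorem; the default value 0 is never reached. *)
Definition adjoint (U : L2 -> L2) : L2 -> L2 :=
  xget 0 [set V | bounded_operator V /\
                  forall F G, l2inner (U F) G = l2inner F (V G)].

(* Closure for the operator norm inside the bounded operators; A is meant to
   consist of bounded operators. *)
Definition norm_closure A : set (L2 -> L2) :=
  [set U | bounded_operator U /\
           forall e : R, 0 < e -> exists2 V, A V & opnorm (U - V) < e].

Definition star_hom A (k : nat) (pi : (L2 -> L2) -> 'M[C]_k) : Prop :=
  [/\ forall a U V, A U -> A V -> pi (a *: U + V) = a *: pi U + pi V,
      forall U V, A U -> A V -> pi (U \o V) = pi U *m pi V &
      forall U, A U -> pi (adjoint U) = map_mx conjc (pi U)^T].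

Definition residually_finite_dimensional A : Prop :=
  exists (k : nat -> nat) (pi : forall n, (L2 -> L2) -> 'M[C]_(k n)),
    [/\ forall n, (0 < k n)%N,
        forall n, star_hom A (pi n) &
        forall U V, A U -> A V -> (forall n, pi n U = pi n V) -> U = V].

Definition is_trace A (tau : (L2 -> L2) -> C) : Prop :=
  [/\ forall a U V, A U -> A V -> tau (a *: U + V) = a * tau U + tau V,
      forall U, A U -> 0 <= tau (adjoint U \o U) &
      forall U V, A U -> A V -> tau (U \o V) = tau (V \o U)].

Definition is_unit_of A (I : L2 -> L2) : Prop :=
  A I /\ forall U, A U -> I \o U = U /\ U \o I = U.

Definition normalized_trace A (tau : (L2 -> L2) -> C) : Prop :=
  is_trace A tau /\ exists2 I, is_unit_of A I & tau I = 1.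

End L2.

Section Koopman.
Variables (E : graph) (G : groupoid (vert E)).
Variable act : G -> prepath E -> prepath E.
Variables (R : realType) (nu : probability (borel_ipath E) R).

(* Functions on E^oo are split according to the range of the path, so kappa_g
   only sees the restriction of F to d(g)E^oo and vanishes off t(g)E^oo. *)
Definition koopman (g : G) (F : L2 nu) : L2 nu :=
  L2class nu (fun x : ipath E =>
    if irng x == gtgt g then F (iact act (ginv g) x) else 0).

(* Meaningful for f in C_c(G), i.e. of finite support. *)
Definition koopman_alg (f : G -> R[i]) : L2 nu -> L2 nu :=
  \sum_(g \in [set g | f g != 0]) f g *: koopman g.

Definition koopman_Cstar : set (L2 nu -> L2 nu) :=
  norm_closure [set koopman_alg f | f in [set f | finite_set [set g | f g != 0]]].

End Koopman.

Arguments koopman {E G} act {R} nu g F.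
Arguments koopman_alg {E G} act {R} nu f F.
Arguments koopman_Cstar {E G} act {R} nu _.

(* Main.v *)
Set Warnings "-notation-overridden,-ambiguous-paths,-notation-incompatible-prefix".
Require Import Defs.
From HB Require Import structures.
From mathcomp Require Import all_boot all_order all_algebra.
From mathcomp Require Import finmap all_classical all_reals all_analysis.
From mathcomp Require Import complex measurable_realfun ring lra.

Set Implicit Arguments.
Unset Strict Implicit.
Unset Printing Implicit Defensive.

Import Order.TTheory GRing.Theory Num.Theory.
Import numFieldNormedType.Exports.

Local Open Scope classical_set_scope.
Local Open Scope ring_scope.
Local Open Scope complex_scope.

(** For a level [n], the indicators [e_a] of the cylinders [Z(a)], with [a] a
path of length [n], span a finite dimensional subspace [H_n] of [L^2], and
[kappa_g e_a] is [e_(g.a)] or [0]. So every [kappa_g] maps [H_n] into itself,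
hence so does every norm limit [U] of finite combinations of them. Since
[kappa_g^* = kappa_(g^-1)], the set of these limits is stable under adjoints,
and compressing to [H_n], that is, taking the matrix of [U] in the orthogonal
basis [e_a], is a *-homomorphism [pi_n] from [C^*(kappa)] to matrices
([level_rep_star_hom]).

The [pi_n] are jointly injective ([koopman_Cstar_rfd]): if [pi_n U = pi_n V]
for all [n], then [U] and [V] agree on all the [e_a], so
[<e_a, U^*F> = <e_a, V^*F>] for all [a] and [F]. Cylinders form a pi-system that
generates the Borel sets, so Dynkin's theorem turns a function orthogonal to
all the [e_a] into [0] ([indicators_total]); therefore [U^* = V^*], and [U = V].
The algebra is unital, because the identity is the sum of the [kappa_u] over
the vertices [u] ([koopman_alg_unit]), so the normalized matrix trace of a
single [pi_n] is already a normalized trace ([level_trace_normalized]).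

Three analytic facts carry this. The first is that every element of
[C^*(kappa)] has an adjoint. It is proved without the Riesz representation
theorem: if [V_k] tends to [U] in norm and each [V_k] has an adjoint, then
[V_k^* G] is a Cauchy sequence, and its limit represents [F |-> <U F, G>]
([norm_closure_adjointable]). This uses the second fact, the completeness of
[L^2] of a finite measure ([riesz_fischer]). The third is that a measurable
bijection between two measurable sets that preserves the measure induces a
bounded operator on [L^2], whose adjoint comes from the inverse bijection
([pull_op_adjoint]); it applies to the action of [g] on infinite paths because
[g] sends cylinders to cylinders of the same level, and the measure of a
cylinder depends on its level alone ([iact_preserves]). *)

(** * The Hilbert space of square integrable functions *)

Section L2InnerProduct.
Context d (T : measurableType d) (R : realType).
Variable mu : {measure set T -> \bar R}.
Local Notation C := R[i].
Local Notation cabs := ComplexField.Normc.normc.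
Implicit Types (F G H : L2 mu) (a : C).

Definition cmeasurable (f : T -> C) :=
  measurable_fun setT (fun x => complex.Re (f x)) /\
  measurable_fun setT (fun x => complex.Im (f x)).

Definition cintegrable (f : T -> C) :=
  mu.-integrable setT (EFin \o (fun x => complex.Re (f x))) /\
  mu.-integrable setT (EFin \o (fun x => complex.Im (f x))).

Lemma cintegral_linear a f g : cintegrable f -> cintegrable g ->
  Cintegral mu (fun x => a * f x + g x) = a * Cintegral mu f + Cintegral mu g.
Proof.
move=> [fr fi] [gr gi]; rewrite /Cintegral.
have mT : measurable [set: T] by [].
case: a => a b.
have i1 (c : R) h : mu.-integrable setT (EFin \o h) ->
    mu.-integrable setT (EFin \o (fun x => c * h x)).
  by move=> ih; exact: (integrableZl mT c ih).
have i2 h k : mu.-integrable setT (EFin \o h) ->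
    mu.-integrable setT (EFin \o k) ->
    mu.-integrable setT (EFin \o (fun x => h x + k x)).
  by move=> ih ik; exact: (integrableD mT ih ik).
rewrite [X in Complex X _](_ : _ = \int[mu]_x ((a * complex.Re (f x) +
      (- b) * complex.Im (f x)) + complex.Re (g x))); last first.
  apply: eq_Rintegral => x _.
  by case: (f x) (g x) => [u v] [u' v'] /=; rewrite mulNr.
rewrite [X in Complex _ X](_ : _ = \int[mu]_x ((a * complex.Im (f x) +
      b * complex.Re (f x)) + complex.Im (g x))); last first.
  apply: eq_Rintegral => x _.
  by case: (f x) (g x) => [u v] [u' v'] /=.
rewrite !RintegralD ?RintegralZl//; try by [exact: i1 | apply: i2; exact: i1].
by apply/eqP; rewrite eq_complex /= !mulNr !eqxx.
Qed.

Lemma cintegral_conj f : cintegrable f ->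
  Cintegral mu (fun x => conjc (f x)) = conjc (Cintegral mu f).
Proof.
move=> [fr fi]; apply/eqP; rewrite eq_complex /=; apply/andP; split; apply/eqP.
  by apply: eq_Rintegral => x _; case: (f x).
rewrite -mulN1r -RintegralZl//; apply: eq_Rintegral => x _; rewrite mulN1r.
by case: (f x).
Qed.

Lemma cintegral_ae f g : cmeasurable f -> cmeasurable g ->
  {ae mu, forall x, f x = g x} -> Cintegral mu f = Cintegral mu g.
Proof.
move=> [fr fi] [gr gi] fg; rewrite /Cintegral /Rintegral.
by congr (Complex (fine _) (fine _)); apply: ae_eq_integral => //;
  try (exact/measurable_EFinP); apply: filterS fg => x /= -> .
Qed.

Lemma cmeasurableM f g : cmeasurable f -> cmeasurable g ->
  cmeasurable (fun x => f x * conjc (g x)).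
Proof.
move=> [fr fi] [gr gi]; split.
  rewrite (_ : (fun x => _) = (fun x => complex.Re (f x) * complex.Re (g x) +
     complex.Im (f x) * complex.Im (g x))).
    by apply: measurable_funD; exact: measurable_funM.
  by apply/funext => x; case: (f x) (g x) => [u v] [u' v'] /=; rewrite mulrN opprK.
rewrite (_ : (fun x => _) = (fun x => complex.Im (f x) * complex.Re (g x) -
     complex.Re (f x) * complex.Im (g x))).
  by apply: measurable_funB; exact: measurable_funM.
apply/funext => x; case: (f x) (g x) => [u v] [u' v'] /=; ring.
Qed.

Lemma cmeasurable_sqint f : square_integrable mu f -> cmeasurable f.
Proof. by case. Qed.

Lemma cintegrableM f g : square_integrable mu f -> square_integrable mu g ->
  cintegrable (fun x => f x * conjc (g x)).
Proof.
move=> /square_integrableP[fr fi] /square_integrableP[gr gi].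
have h u v : u \in Lfun mu 2%:E -> v \in Lfun mu 2%:E ->
    mu.-integrable setT (EFin \o (fun x => u x * v x)).
  move=> hu hv; apply/Lfun1_integrable; exact: Lfun2_mul_Lfun1.
have mT : measurable [set: T] by [].
split.
  rewrite (_ : (fun x => _) = (fun x => complex.Re (f x) * complex.Re (g x) +
     complex.Im (f x) * complex.Im (g x))).
    exact: (integrableD mT (h _ _ fr gr) (h _ _ fi gi)).
  by apply/funext => x; case: (f x) (g x) => [u v] [u' v'] /=; rewrite mulrN opprK.
rewrite (_ : (fun x => _) = (fun x => complex.Im (f x) * complex.Re (g x) -
     complex.Re (f x) * complex.Im (g x))).
  exact: (integrableB mT (h _ _ fi gr) (h _ _ fr gi)).
apply/funext => x; case: (f x) (g x) => [u v] [u' v'] /=; ring.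
Qed.

Lemma sqint_l2fun (f : l2fun mu) : square_integrable mu f.
Proof. by case: f => f /= /asboolP. Qed.

Lemma sqint_L2 F : square_integrable mu F.
Proof. exact: sqint_l2fun. Qed.

(** [l2inner] is computed on the representatives chosen by [repr]; it does not
    depend on that choice. *)
Lemma inner_mk (f g : l2fun mu) :
  l2inner (L2mk f) (L2mk g) = Cintegral mu (fun x => f x * conjc (g x)).
Proof.
apply: cintegral_ae.
- by apply: cmeasurableM; apply: cmeasurable_sqint; exact: sqint_L2.
- by apply: cmeasurableM; apply: cmeasurable_sqint; exact: sqint_l2fun.
- by apply: filterS2 (repr_L2mk f) (repr_L2mk g) => x; rewrite /L2_fun => -> ->.
Qed.

Lemma L2Dmk a F G : a *: F + G = L2mk (a *: repr F + repr G).
Proof.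
by rewrite -[in LHS](L2mkK F) -[in LHS](L2mkK G) /GRing.scale/= L2mkZ -L2mkD.
Qed.

Lemma innerDl a F G H :
  l2inner (a *: F + G) H = a * l2inner F H + l2inner G H.
Proof.
rewrite L2Dmk -{1}(L2mkK H) inner_mk -cintegral_linear; last first.
- exact: cintegrableM (sqint_L2 G) (sqint_L2 H).
- exact: cintegrableM (sqint_L2 F) (sqint_L2 H).
congr Cintegral; apply/funext => x.
by rewrite l2funD l2funZ mulrDl mulrA.
Qed.

Lemma innerC F G : l2inner G F = conjc (l2inner F G).
Proof.
rewrite -cintegral_conj; last exact: cintegrableM (sqint_L2 F) (sqint_L2 G).
congr Cintegral; apply/funext => x.
by rewrite rmorphM/= conjcK mulrC.
Qed.

Lemma cabs_ge0 (z : C) : 0 <= cabs z.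
Proof. by case: z => a b; exact: sqrtr_ge0. Qed.

Lemma mulJ_cabs (z : C) : z * conjc z = (cabs z ^+ 2)%:C.
Proof.
case: z => a b; rewrite /= sqr_sqrtr ?addr_ge0 ?sqr_ge0//.
by apply/eqP; rewrite eq_complex /=; apply/andP; split; apply/eqP; ring.
Qed.

Lemma l2norm_ge0 F : 0 <= l2norm F.
Proof. exact/fine_ge0/Lnorm_ge0. Qed.

Lemma l2norm_sqr F : (l2norm F ^+ 2)%:E = (\int[mu]_x (cabs (F x) ^+ 2)%:E)%E.
Proof.
have [mr mi fin] := sqint_L2 F.
rewrite -powR_mulrn ?l2norm_ge0// -fine_poweR fineK; last first.
  by rewrite fin_num_poweR// ge0_fin_numE// Lnorm_ge0.
rewrite poweR_Lnorm//; apply: eq_integral => x _ /=.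
by rewrite ger0_norm ?cabs_ge0// powR_mulrn ?cabs_ge0.
Qed.

Lemma inner_sqnorm F : l2inner F F = (l2norm F ^+ 2)%:C.
Proof.
apply/eqP; rewrite eq_complex; apply/andP; split; apply/eqP => /=.
  rewrite /Rintegral; under eq_integral do rewrite mulJ_cabs/=.
  by rewrite -l2norm_sqr.
rewrite /Rintegral integral0_eq// => x _ /=.
by rewrite mulJ_cabs.
Qed.

Lemma l2norm_eq0 F : l2norm F = 0 -> F = 0.
Proof.
move=> F0; have [mr mi _] := sqint_L2 F.
have := l2norm_sqr F; rewrite F0 expr0n/= => /esym F2.
rewrite -(L2mkK F); apply/L2mkP.
have mc := measurable_cabs mr mi.
have : ae_eq mu setT (fun x => (cabs (F x) ^+ 2)%:E) (cst 0%E).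
  apply/(ae_eq_integral_abs mu measurableT).
    by apply/measurable_EFinP; exact: measurable_funX.
  rewrite -[RHS]F2; apply: eq_integral => x _.
  by rewrite gee0_abs// lee_fin sqr_ge0.
apply: filterS => x /= /(_ I) [] /eqP; rewrite sqrf_eq0 => /eqP.
exact: ComplexField.Normc.eq0_normc.
Qed.

Lemma innerDr a F G H :
  l2inner H (a *: F + G) = conjc a * l2inner H F + l2inner H G.
Proof. by rewrite [LHS]innerC innerDl rmorphD rmorphM/= (innerC F H) (innerC G H). Qed.

Lemma inner0l G : l2inner 0 G = 0.
Proof.
have := innerDl 1 0 0 G; rewrite scale1r addr0 mul1r.
by move/eqP; rewrite -subr_eq subrr => /eqP.
Qed.

Lemma inner0r G : l2inner G 0 = 0.
Proof. by rewrite innerC inner0l conjc0. Qed.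

Lemma innerZl a F G : l2inner (a *: F) G = a * l2inner F G.
Proof. by rewrite -[a *: F]addr0 innerDl inner0l addr0. Qed.

Lemma innerZr a F G : l2inner G (a *: F) = conjc a * l2inner G F.
Proof. by rewrite [LHS]innerC innerZl rmorphM/= (innerC F G). Qed.

Lemma innerDll F G H : l2inner (F + G) H = l2inner F H + l2inner G H.
Proof. by rewrite -[F]scale1r innerDl mul1r scale1r. Qed.

Lemma innerDrr F G H : l2inner H (F + G) = l2inner H F + l2inner H G.
Proof. by rewrite [LHS]innerC innerDll rmorphD/= (innerC F H) (innerC G H). Qed.

Lemma innerNl F G : l2inner (- F) G = - l2inner F G.
Proof. by rewrite -scaleN1r innerZl mulN1r. Qed.

Lemma innerBl F G H : l2inner (F - G) H = l2inner F H - l2inner G H.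
Proof. by rewrite innerDll innerNl. Qed.

Lemma innerBr F G H : l2inner H (F - G) = l2inner H F - l2inner H G.
Proof. by rewrite [LHS]innerC innerBl rmorphB/= (innerC F H) (innerC G H). Qed.

Lemma inner_suml (I : Type) (r : seq I) (F : I -> L2 mu) G :
  l2inner (\sum_(i <- r) F i) G = \sum_(i <- r) l2inner (F i) G.
Proof.
apply: (big_morph (fun F => l2inner F G)) => [F1 F2|]; first exact: innerDll.
exact: inner0l.
Qed.

Lemma l2norm0 : l2norm (0 : L2 mu) = 0.
Proof.
apply/eqP; rewrite -sqrf_eq0; apply/eqP/complexI.
by rewrite -inner_sqnorm inner0l.
Qed.

(** The squared norm of the component of [F] orthogonal to [G] is nonnegative;
    the division by [||G||^2] is avoided by rescaling. *)
Lemma cauchy_schwarz F G : cabs (l2inner F G) <= l2norm F * l2norm G.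
Proof.
have [G0|G0] := eqVneq (l2norm G) 0.
  by rewrite (l2norm_eq0 G0) inner0r ComplexField.Normc.normc0 l2norm0 mulr0.
have Gp : 0 < l2norm G ^+ 2 by rewrite exprn_gt0// lt_neqAle eq_sym G0 l2norm_ge0.
rewrite -(@ler_pXn2r _ 2) ?nnegrE ?cabs_ge0 ?mulr_ge0 ?l2norm_ge0//.
pose z := l2inner F G; pose y := (l2norm G ^+ 2)%:C.
have : l2inner (y *: F - z *: G) (y *: F - z *: G) =
    (l2norm G ^+ 2 * (l2norm F ^+ 2 * l2norm G ^+ 2 - cabs z ^+ 2))%:C.
  rewrite innerBl !innerBr !innerZl !innerZr (innerC F G) -/z.
  rewrite !inner_sqnorm -/y (conjc_real (l2norm G ^+ 2)) -/y.
  have -> : cabs z ^+ 2 = complex.Re z ^+ 2 + complex.Im z ^+ 2.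
    by case: z => u v /=; rewrite sqr_sqrtr ?addr_ge0 ?sqr_ge0.
  rewrite /y; case: z => u v; apply/eqP; rewrite eq_complex /=.
  by apply/andP; split; apply/eqP; ring.
rewrite inner_sqnorm => /complexI h.
have := sqr_ge0 (l2norm (y *: F - z *: G)).
by rewrite h pmulr_rge0// subr_ge0 exprMn.
Qed.

Lemma l2normZ a F : l2norm (a *: F) = cabs a * l2norm F.
Proof.
apply/eqP; rewrite -(@eqrXn2 _ 2) ?mulr_ge0 ?cabs_ge0 ?l2norm_ge0//.
apply/eqP/complexI; rewrite -inner_sqnorm innerZl innerZr inner_sqnorm.
by rewrite mulrA mulJ_cabs -rmorphM/= exprMn.
Qed.

Lemma l2normN F : l2norm (- F) = l2norm F.
Proof.
rewrite -scaleN1r l2normZ (_ : cabs (-1) = 1) ?mul1r//=.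
by rewrite oppr0 expr0n/= addr0 sqrrN expr1n sqrtr1.
Qed.

Lemma l2norm_triangle F G : l2norm (F + G) <= l2norm F + l2norm G.
Proof.
rewrite -(@ler_pXn2r _ 2) ?nnegrE ?addr_ge0 ?l2norm_ge0//.
have : l2norm (F + G) ^+ 2 =
    l2norm F ^+ 2 + complex.Re (l2inner F G) *+ 2 + l2norm G ^+ 2.
  apply: complexI; rewrite -inner_sqnorm innerDll !innerDrr (innerC F G).
  rewrite !inner_sqnorm; apply/eqP; rewrite eq_complex.
  by case: (l2inner F G) => u v /=; apply/andP; split; apply/eqP; ring.
move=> ->; rewrite sqrrD lerD2r lerD2l lerMn2r/=.
apply: le_trans (cauchy_schwarz F G); apply: le_trans (Re_le_cabs _).
exact: ler_norm.
Qed.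

Lemma l2norm_distC F G : l2norm (F - G) = l2norm (G - F).
Proof. by rewrite -opprB l2normN. Qed.

Lemma l2norm_triangleB F G H : l2norm (F - H) <= l2norm (F - G) + l2norm (G - H).
Proof.
by apply: le_trans (l2norm_triangle _ _); rewrite addrA subrK.
Qed.

(** Adjoints are only known through inner products, so equalities between
    their values are tested against all vectors. *)
Lemma inner_ext F G : (forall H, l2inner H F = l2inner H G) -> F = G.
Proof.
move=> FG; apply/eqP; rewrite -subr_eq0; apply/eqP/l2norm_eq0/eqP.
rewrite -sqrf_eq0; apply/eqP/complexI.
by rewrite -inner_sqnorm innerBr FG subrr.
Qed.

End L2InnerProduct.

(** * Completeness *)

(** The telescoping series of [u] converges absolutely. *)
Lemma cvg_of_bounded_variation (R : realType) (u : R^nat) (M : R) :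
  (forall n, \sum_(0 <= k < n) `|u k.+1 - u k| <= M) -> cvgn u.
Proof.
move=> uM.
have : cvgn (series (telescope u)).
  apply: normed_cvg; apply: nondecreasing_is_cvgn.
    by apply: nondecreasing_series => n _ _; exact: normr_ge0.
  by exists M => _ [n _ <-] /=; exact: uM.
move=> /cvg_ex[l ul]; apply/cvg_ex; exists (u 0%N + l).
rewrite (_ : u = (fun n => u 0%N + series (telescope u) n)); last first.
  by apply/funext => n; exact: eq_sum_telescope.
by rewrite -eq_sum_telescope; apply: cvgD => //; exact: cvg_cst.
Qed.

Lemma sum_half (R : realType) n :
  \sum_(0 <= k < n) (2^-1 : R) ^+ k = 2 - 2 * 2^-1 ^+ n.
Proof.
elim: n => [|n IH]; first by rewrite big_geq// expr0 mulr1 subrr.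
by rewrite big_nat_recr//= IH exprS; field.
Qed.

Section L2Completeness.
Context d (T : measurableType d) (R : realType).
Variable mu : {measure set T -> \bar R}.
Local Notation C := R[i].
Local Notation cabs := ComplexField.Normc.normc.
Implicit Types (F G H : L2 mu) (a : C).

Lemma square_integrable_of_integral (f : T -> C) : cmeasurable f ->
  (\int[mu]_x (cabs (f x) ^+ 2)%:E < +oo)%E -> square_integrable mu f.
Proof.
move=> [mr mi] fin; split => //; rewrite /finite_norm.
apply: (@lty_poweRy _ _ 2); first by rewrite pnatr_eq0.
rewrite poweR_Lnorm ?pnatr_eq0//; apply: le_lt_trans fin.
rewrite le_eqVlt; apply/orP; left; apply/eqP; apply: eq_integral => x _ /=.
by rewrite ger0_norm ?cabs_ge0// powR_mulrn ?cabs_ge0.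
Qed.

Lemma measurable_cabs2 (f : T -> C) : cmeasurable f ->
  measurable_fun setT (fun x => (cabs (f x) ^+ 2)%:E).
Proof.
move=> [mr mi]; apply/measurable_EFinP/measurable_funX; exact: measurable_cabs.
Qed.

Lemma cmeasurable_L2 F : cmeasurable F.
Proof. exact: cmeasurable_sqint (sqint_L2 F). Qed.

Lemma l2norm_sqr_ae F (f : T -> C) : cmeasurable f ->
  {ae mu, forall x, F x = f x} ->
  (l2norm F ^+ 2)%:E = (\int[mu]_x (cabs (f x) ^+ 2)%:E)%E.
Proof.
move=> mf Ff; rewrite l2norm_sqr; apply: ge0_ae_eq_integral => //.
- exact: measurable_cabs2 (cmeasurable_L2 F).
- exact: measurable_cabs2.
- by move=> x _; rewrite lee_fin sqr_ge0.
- by move=> x _; rewrite lee_fin sqr_ge0.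
- by apply: filterS Ff => x /= ->.
Qed.

Lemma L2D_ae F G : {ae mu, forall x, L2_fun (F + G) x = F x + G x}.
Proof. exact: (repr_L2mk (repr F + repr G)). Qed.

Lemma L2N_ae F : {ae mu, forall x, L2_fun (- F) x = - F x}.
Proof. exact: (repr_L2mk (- repr F)). Qed.

Lemma L2B_ae F G : {ae mu, forall x, L2_fun (F - G) x = F x - G x}.
Proof. by apply: filterS2 (L2D_ae F (- G)) (L2N_ae G) => x -> ->. Qed.

Lemma cmeasurableB (f g : T -> C) : cmeasurable f -> cmeasurable g ->
  cmeasurable (fun x => f x - g x).
Proof.
move=> [fr fi] [gr gi]; split.
  rewrite (_ : (fun x => _) = (fun x => complex.Re (f x) - complex.Re (g x))).
    exact: measurable_funB.
  by apply/funext => x; case: (f x) (g x) => [? ?] [].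
rewrite (_ : (fun x => _) = (fun x => complex.Im (f x) - complex.Im (g x))).
  exact: measurable_funB.
by apply/funext => x; case: (f x) (g x) => [? ?] [].
Qed.

Lemma l2norm_sub_sqr F G :
  (l2norm (F - G) ^+ 2)%:E = (\int[mu]_x (cabs (F x - G x) ^+ 2)%:E)%E.
Proof.
apply: l2norm_sqr_ae; last exact: L2B_ae.
by apply: cmeasurableB; exact: cmeasurable_L2.
Qed.

Section FastCauchy.
Hypothesis mu_fin : (mu setT < +oo)%E.
Variable F : nat -> L2 mu.
Hypothesis F_cauchy : forall k, l2norm (F k.+1 - F k) <= 2^-1 ^+ k.

Let step k x := cabs (F k.+1 x - F k x).

Let measurable_step k : measurable_fun setT (step k).
Proof.
have [mr mi] := cmeasurableB (cmeasurable_L2 (F k.+1)) (cmeasurable_L2 (F k)).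
exact: measurable_cabs.
Qed.

Let step_ge0 k x : 0 <= step k x. Proof. exact: cabs_ge0. Qed.

(** By the inequality [s <= 2^k s^2 + 2^-k], the bound on the [L^2] norms of the
    steps gives a summable bound on their [L^1] norms. *)
Let integral_step k :
  (\int[mu]_x (step k x)%:E <= ((1 + fine (mu setT)) * 2^-1 ^+ k)%:E)%E.
Proof.
have muE : mu setT = (fine (mu setT))%:E by rewrite fineK// ge0_fin_numE.
have h0 : 0 < (2^-1 : R) ^+ k by rewrite exprn_gt0.
have m2 : measurable_fun setT (fun x => (step k x ^+ 2)%:E : \bar R).
  by apply/measurable_EFinP/measurable_funX.
apply: (@le_trans _ _ (\int[mu]_x ((2 ^+ k)%:E * (step k x ^+ 2)%:E +
    (2^-1 ^+ k)%:E))%E).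
  apply: ge0_le_integral => //.
  - by move=> x _; rewrite lee_fin.
  - exact/measurable_EFinP.
  - by apply: emeasurable_funD => //; exact: measurable_funeM.
  - move=> x _; rewrite -EFinM -EFinD lee_fin exprVn.
    set s := 2 ^+ k; have s0 : 0 < s by rewrite exprn_gt0.
    have : 0 <= (s * step k x - 1) ^+ 2 / s by rewrite divr_ge0 ?sqr_ge0// ltW.
    have -> : (s * step k x - 1) ^+ 2 / s =
      s * step k x ^+ 2 + s^-1 - 2 * step k x by field; exact: lt0r_neq0.
    have := step_ge0 k x; lra.
rewrite ge0_integralD//; last first.
- exact: measurable_funeM.
- by move=> x _; rewrite mule_ge0// lee_fin ?exprn_ge0// sqr_ge0.
rewrite ge0_integralZl//; last by move=> x _; rewrite lee_fin sqr_ge0.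
rewrite -l2norm_sub_sqr integral_cst// muE -!EFinM -EFinD lee_fin mulrDl mul1r.
rewrite [X in _ <= _ + X]mulrC lerD2r.
have : l2norm (F k.+1 - F k) ^+ 2 <= (2^-1 ^+ k) ^+ 2.
  by rewrite lerXn2r// nnegrE ?l2norm_ge0// exprn_ge0// invr_ge0.
move=> /(ler_wpM2l (exprn_ge0 k (ler0n R 2))) /le_trans; apply.
by rewrite expr2 mulrA -exprMn mulfV// expr1n mul1r.
Qed.

(** The sum of the [L^1] norms is finite, so the sum of the steps is integrable
    and therefore finite almost everywhere. *)
Let steps_summable : {ae mu, forall x, exists M,
  forall n, \sum_(0 <= k < n) step k x <= M}.
Proof.
have ms k : measurable_fun setT (fun x => (step k x)%:E : \bar R).
  exact/measurable_EFinP.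
have s0 k x : setT x -> (0 <= (step k x)%:E)%E by rewrite lee_fin.
pose M := (1 + fine (mu setT)) * 2.
have int_fin : (\int[mu]_x (\sum_(k <oo) (step k x)%:E) <= M%:E)%E.
  rewrite integral_nneseries//; apply: lime_le.
    by apply: is_cvg_nneseries => k _ _; apply: integral_ge0 => x _; exact: s0.
  apply: nearW => n.
  apply: (@le_trans _ _ (\sum_(0 <= k < n) ((1 + fine (mu setT)) * 2^-1 ^+ k)%:E)%E).
    by apply: lee_sum => k _; exact: integral_step.
  rewrite sumEFin lee_fin -mulr_sumr sum_half ler_wpM2l ?addr_ge0 ?fine_ge0//.
  by rewrite gerBl mulr_ge0// exprn_ge0.
have : mu.-integrable setT (fun x => \sum_(k <oo) (step k x)%:E)%E.
  apply/integrableP; split.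
    by apply: ge0_emeasurable_sum => // k x _ _; exact: s0.
  apply: le_lt_trans (ltry M); apply: le_trans int_fin.
  rewrite le_eqVlt; apply/orP; left; apply/eqP/eq_integral => x _.
  by rewrite gee0_abs// nneseries_ge0// => k _ _; exact: s0.
move=> /(integrable_ae measurableT); apply: filterS => x /(_ I) xfin.
exists (fine (\sum_(k <oo) (step k x)%:E)%E) => n.
rewrite -lee_fin fineK// -sumEFin; apply: nneseries_lim_ge => k _ _.
exact: s0.
Qed.

Lemma riesz_fischer_telescope k m :
  l2norm (F (k + m) - F k) <= 2 * 2^-1 ^+ k - 2 * 2^-1 ^+ (k + m).
Proof.
elim: m => [|m IH]; first by rewrite addn0 !subrr l2norm0.
apply: le_trans (l2norm_triangleB _ (F (k + m)) _) _.
rewrite addnS exprS; have := F_cauchy (k + m); move: IH.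
set x := 2^-1 ^+ (k + m); lra.
Qed.

(** The upper limit makes sense at every point and is measurable; it is the
    limit almost everywhere. *)
Let limRe x := fine (limn_esup (fun k => (complex.Re (F k x))%:E)).
Let limIm x := fine (limn_esup (fun k => (complex.Im (F k x))%:E)).
Let lim x : C := Complex (limRe x) (limIm x).

Let measurable_lim : cmeasurable lim.
Proof.
have h (u : nat -> T -> R) : (forall k, measurable_fun setT (u k)) ->
    measurable_fun setT (fun x => fine (limn_esup (fun k => (u k x)%:E))).
  move=> mu_; apply: (@measurableT_comp _ _ _ _ _ _ (@fine R)) => //.
  by apply: (@measurable_fun_limn_esup _ _ _ _ (fun k x => (u k x)%:E)) => k;
    exact/measurable_EFinP.
split; first by apply: (h (fun k x => complex.Re (F k x))) => k;
  case: (cmeasurable_L2 (F k)).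
by apply: (h (fun k x => complex.Im (F k x))) => k;
  case: (cmeasurable_L2 (F k)).
Qed.

Let cvg_lim_ae : {ae mu, forall x,
  complex.Re (F k x) @[k --> \oo] --> limRe x /\
  complex.Im (F k x) @[k --> \oo] --> limIm x}.
Proof.
apply: filterS steps_summable => x [M sM].
have cvg_fine (u : R^nat) : (forall k, `|u k.+1 - u k| <= step k x) ->
    u @ \oo --> fine (limn_esup (fun k => (u k)%:E)).
  move=> us; have /cvg_ex[l ul] : cvgn u.
    apply: (@cvg_of_bounded_variation _ _ M) => n; apply: le_trans (sM n).
    by apply: ler_sum => k _.
  have ulE : (u k)%:E @[k --> \oo] --> l%:E.
    by apply: cvg_EFin; [exact: nearW|exact: ul].
  by rewrite (cvg_limn_einf_sup ulE).2.
split; apply: cvg_fine => k; rewrite /step.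
  by apply: le_trans (Re_le_cabs _); case: (F k.+1 x) (F k x) => [? ?] [].
by apply: le_trans (Im_le_cabs _); case: (F k.+1 x) (F k x) => [? ?] [].
Qed.

(** Fatou's lemma carries the bound on [||F (k + m) - F k||] to the pointwise
    limit as [m] grows. *)
Let integral_lim k :
  (\int[mu]_x (cabs (lim x - F k x) ^+ 2)%:E <= ((2 * 2^-1 ^+ k) ^+ 2)%:E)%E.
Proof.
pose h m x := (cabs (F (m + k)%N x - F k x) ^+ 2)%:E.
have mh m : measurable_fun setT (h m).
  by apply: measurable_cabs2; apply: cmeasurableB; exact: cmeasurable_L2.
have h0 m x : setT x -> (0 <= h m x)%E by rewrite lee_fin sqr_ge0.
rewrite (@ge0_ae_eq_integral _ _ _ _ _ _ (fun x => limn_einf (h ^~ x)))//.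
- apply: le_trans (fatou mu measurableT mh h0) _.
  rewrite limn_einf_lim; apply: lime_le.
    by apply: is_cvg_einfs.
  apply: nearW => n; apply: ge_ereal_inf.
  exists (\int[mu]_x h n x)%E; first by exists n => //=.
  rewrite -l2norm_sub_sqr lee_fin lerXn2r ?nnegrE ?l2norm_ge0 ?mulr_ge0 ?exprn_ge0//.
  rewrite addnC; apply: le_trans (riesz_fischer_telescope k n) _.
  by rewrite gerBl mulr_ge0// exprn_ge0.
- by apply: measurable_cabs2; apply: cmeasurableB => //; exact: cmeasurable_L2.
- rewrite /limn_einf; apply: measurableT_comp => //.
  by apply: (@measurable_fun_limn_esup _ _ _ _ (fun m x => - h m x)%E) => m;
    exact: measurableT_comp.
- by move=> x _; rewrite lee_fin sqr_ge0.
- move=> x _; rewrite limn_einf_lim; apply: lime_ge; first by apply: is_cvg_einfs.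
  by apply: nearW => n; apply: le_ereal_inf_tmp => _ [m _ <-]; exact: h0.
- apply: filterS cvg_lim_ae => x [cr ci] _; apply/esym.
  have cabs2 (z : C) : cabs z ^+ 2 = complex.Re z ^+ 2 + complex.Im z ^+ 2.
    by case: z => u v /=; rewrite sqr_sqrtr ?addr_ge0 ?sqr_ge0.
  apply: (cvg_limn_einf_sup _).1; apply: cvg_EFin; first exact: nearW.
  pose w j := (complex.Re (F j x) - complex.Re (F k x)) ^+ 2 +
    (complex.Im (F j x) - complex.Im (F k x)) ^+ 2.
  have wl : w j @[j --> \oo] --> cabs (lim x - F k x) ^+ 2.
    rewrite cabs2.
    have -> : complex.Re (lim x - F k x) = limRe x - complex.Re (F k x).
      by rewrite /lim; case: (F k x).
    have -> : complex.Im (lim x - F k x) = limIm x - complex.Im (F k x).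
      by rewrite /lim; case: (F k x).
    by apply: cvgD; rewrite expr2; apply: cvgM; apply: cvgB => //; exact: cvg_cst.
  suff -> : fine \o (fun m => h m x) = [sequence w (m + k)%N]_m.
    by rewrite (cvg_shiftn k w).
  apply/funext => m /=; by rewrite /w cabs2; case: (F (m + k)%N x) (F k x) => [? ?] [].
Qed.

(** [L^2] of a finite measure is complete. A sequence with steps bounded by a
    geometric series is enough, and for it the limit exists almost everywhere. *)
Theorem riesz_fischer :
  exists L : L2 mu, forall k, l2norm (L - F k) <= 2 * 2^-1 ^+ k.
Proof.
(* Subtracting F 0 gives a function whose L^2 norm is bounded by integral_lim. *)
pose h x := lim x - F 0%N x.
have mh : cmeasurable h by apply: cmeasurableB => //; exact: cmeasurable_L2.
have sh : square_integrable mu h.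
  apply: square_integrable_of_integral => //.
  by apply: le_lt_trans (integral_lim 0) _; exact: ltry.
pose L := L2class mu h + F 0%N.
have Llim : {ae mu, forall x, L2_fun L x = lim x}.
  apply: filterS2 (L2D_ae (L2class mu h) (F 0%N)) (L2classE sh) => x -> ->.
  by rewrite /h subrK.
exists L => k.
rewrite -(@ler_pXn2r _ 2) ?nnegrE ?l2norm_ge0 ?mulr_ge0 ?exprn_ge0//.
rewrite -lee_fin (@l2norm_sqr_ae _ (fun x => lim x - F k x)).
- exact: integral_lim.
- by apply: cmeasurableB => //; exact: cmeasurable_L2.
- by apply: filterS2 (L2B_ae L (F k)) Llim => x -> ->.
Qed.

End FastCauchy.
End L2Completeness.

(** * Bounded operators, adjoints and norm limits *)

Lemma half_small (R : realType) (e : R) : 0 < e -> exists k, 2^-1 ^+ k < e.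
Proof.
move=> e0; exists (Num.Def.archi_bound e^-1).
rewrite exprVn invf_plt ?posrE ?exprn_gt0//.
apply: lt_trans (archi_boundP _) _; first by rewrite invr_ge0 ltW.
by rewrite -natrX ltr_nat ltn_expl.
Qed.

Section Operators.
Context d (T : measurableType d) (R : realType).
Variable mu : {measure set T -> \bar R}.
Local Notation C := R[i].
Local Notation cabs := ComplexField.Normc.normc.
Implicit Types (F G H : L2 mu) (a : C) (U V : L2 mu -> L2 mu).
Implicit Types A : set (L2 mu -> L2 mu).

Definition adjoint_of U V := forall F G, l2inner (U F) G = l2inner F (V G).

Lemma bounded0 U : bounded_operator U -> U 0 = 0.
Proof. by move=> [linU _]; have := linU (-1) 0 0; rewrite !scaleN1r !addNr. Qed.

Lemma boundedZ U a F : bounded_operator U -> U (a *: F) = a *: U F.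
Proof.
move=> bU; have [linU _] := bU.
by have := linU a F 0; rewrite (bounded0 bU) !addr0.
Qed.

Lemma l2norm_opnorm U F : bounded_operator U ->
  l2norm (U F) <= opnorm U * l2norm F.
Proof.
move=> bU; have [linU [c Uc]] := bU.
have [F0|F0] := eqVneq (l2norm F) 0.
  by rewrite (l2norm_eq0 F0) (bounded0 bU) l2norm0 mulr0.
have Fp : 0 < l2norm F by rewrite lt_neqAle eq_sym F0 l2norm_ge0.
have cE (x : R) : 0 <= x -> cabs x%:C = x.
  by move=> x0; rewrite /= expr0n/= addr0 sqrtr_sqr ger0_norm.
rewrite -ler_pdivrMr//; apply: ub_le_sup.
  exists `|c| => _ [G /= G1 <-]; apply: le_trans (Uc G) _.
  apply: (@le_trans _ _ (`|c| * l2norm G)).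
    by rewrite ler_wpM2r ?l2norm_ge0// ler_norm.
  by rewrite ler_piMr.
exists (((l2norm F)^-1)%:C *: F) => /=.
  by rewrite l2normZ cE ?invr_ge0 ?l2norm_ge0// mulVf.
by rewrite boundedZ// l2normZ cE ?invr_ge0 ?l2norm_ge0// mulrC.
Qed.

Lemma bounded_op_lin a U V : bounded_operator U -> bounded_operator V ->
  bounded_operator (a *: U + V).
Proof.
move=> [linU [c Uc]] [linV [c' Vc]]; split.
  move=> b F G; rewrite !fctE linU linV !scalerDr !scalerA (mulrC b a).
  by rewrite addrACA.
exists (cabs a * c + c') => F; rewrite !fctE.
apply: le_trans (l2norm_triangle _ _) _.
by rewrite l2normZ mulrDl lerD// -mulrA ler_wpM2l// cabs_ge0.
Qed.

Lemma bounded_op0 : bounded_operator (0 : L2 mu -> L2 mu).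
Proof.
have z F : (0 : L2 mu -> L2 mu) F = 0 by [].
by split=> [a F G|]; [rewrite !z scaler0 addr0|exists 0 => F; rewrite z l2norm0 mul0r].
Qed.

Lemma bounded_opB U V : bounded_operator U -> bounded_operator V ->
  bounded_operator (U - V).
Proof.
by move=> bU bV; rewrite addrC -scaleN1r; exact: bounded_op_lin.
Qed.

Lemma adjoint_of_lin a U V U' V' : adjoint_of U U' -> adjoint_of V V' ->
  adjoint_of (a *: U + V) (conjc a *: U' + V').
Proof.
by move=> UU' VV' F G; rewrite !fctE innerDl innerDr UU' VV' conjcK.
Qed.

Lemma adjoint_of0 : adjoint_of (0 : L2 mu -> L2 mu) 0.
Proof. by move=> F G; rewrite [LHS]inner0l [RHS]inner0r. Qed.

(** [||V F||^2 = <U V F, F> <= c ||V F|| ||F||]. *)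
Lemma adjoint_norm_le U V c F : 0 <= c -> adjoint_of U V ->
  (forall G, l2norm (U G) <= c * l2norm G) -> l2norm (V F) <= c * l2norm F.
Proof.
move=> c0 UV Uc; have [VF0|VF0] := eqVneq (l2norm (V F)) 0.
  by rewrite VF0 mulr_ge0// l2norm_ge0.
have VFp : 0 < l2norm (V F) by rewrite lt_neqAle eq_sym VF0 l2norm_ge0.
rewrite -(ler_pM2l VFp) -expr2.
have -> : l2norm (V F) ^+ 2 = complex.Re (l2inner (U (V F)) F).
  by rewrite UV inner_sqnorm.
apply: le_trans (ler_norm _) _; apply: le_trans (Re_le_cabs _) _.
apply: le_trans (cauchy_schwarz _ _) _.
rewrite mulrA (mulrC _ c); apply: ler_wpM2r; first exact: l2norm_ge0.
exact: Uc.
Qed.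

Lemma adjoint_of_bounded U V : bounded_operator U -> adjoint_of U V ->
  bounded_operator V.
Proof.
move=> [_ [c Uc]] UV; split.
  move=> a F G; apply: inner_ext => H.
  by rewrite innerDr -!UV innerDr.
exists `|c| => F; apply: (adjoint_norm_le (U := U)) => // G.
apply: le_trans (Uc G) _; apply: ler_wpM2r; first exact: l2norm_ge0.
exact: ler_norm.
Qed.

(** At most one operator satisfies the defining relation of the adjoint, so the
    choice made by [xget] in [adjoint] is forced once one is exhibited. *)
Lemma adjointE U V : bounded_operator U -> adjoint_of U V -> adjoint U = V.
Proof.
move=> bU UV; apply: xget_unique.
  by split; [exact: adjoint_of_bounded UV|].
move=> W [_ UW]; apply/funext => G; apply: inner_ext => F.
by rewrite -UV -UW.
Qed.

Lemma adjoint_ofP U : bounded_operator U -> (exists V, adjoint_of U V) ->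
  adjoint_of U (adjoint U).
Proof. by move=> bU [V UV]; rewrite (adjointE bU UV). Qed.

(** Orthogonality of [V F] to [G] is a closed condition on [V]. This is what
    carries the invariance of subspaces to norm limits. *)
Lemma norm_closure_inner0 A U F G : norm_closure A U ->
  (forall V, A V -> bounded_operator V) ->
  (forall V, A V -> l2inner (V F) G = 0) -> l2inner (U F) G = 0.
Proof.
move=> [bU AU] Ab A0; apply: ComplexField.Normc.eq0_normc.
apply/eqP; rewrite eq_le cabs_ge0 andbT.
apply/ler_addgt0Pr => e e0; rewrite add0r.
pose c := l2norm F * l2norm G; have c0 : 0 <= c by rewrite mulr_ge0 ?l2norm_ge0.
have c1 : 0 < c + 1 by rewrite ltr_wpDl.
have [V AV UV] := AU (e / (c + 1)) (divr_gt0 e0 c1).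
have -> : l2inner (U F) G = l2inner ((U - V) F) G.
  by rewrite !fctE innerBl (A0 V AV) subr0.
apply: le_trans (cauchy_schwarz _ _) _.
apply: (@le_trans _ _ (e / (c + 1) * c)).
  rewrite /c mulrA ler_wpM2r ?l2norm_ge0//.
  have bUV := bounded_opB bU (Ab _ AV).
  apply: le_trans (l2norm_opnorm F bUV) _.
  by rewrite ler_wpM2r ?l2norm_ge0// ltW.
by rewrite mulrAC ler_pdivrMr// ler_wpM2l ?(ltW e0)// lerDl.
Qed.

(** If [V_k] tends to [U] fast enough, then [V_k^* G] is a Cauchy sequence, as
    [||V_k^* - V_l^*|| <= ||V_k - V_l||]. Its limit [W] satisfies
    [<U F, G> = <F, W>]. The sequence [V_k] is chosen separately for each [G], so
    that the steps are bounded by [2^-k] whatever the norm of [G] is. *)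
Lemma norm_closure_adjointable A U : (mu setT < +oo)%E -> norm_closure A U ->
  (forall V, A V -> bounded_operator V) ->
  (forall V, A V -> exists V', adjoint_of V V') ->
  exists U', adjoint_of U U'.
Proof.
move=> mufin [bU AU] Ab Aadj.
suff /choice[U' U'P] : forall G, exists W, forall F, l2inner (U F) G = l2inner F W.
  by exists U' => F G; exact: U'P.
move=> G; pose m := l2norm G + 1.
have m0 : 0 < m by rewrite ltr_wpDl ?l2norm_ge0.
(* two consecutive errors add up to at most 2^-k / ||G|| *)
pose eps k := 2^-1 ^+ k / (2 * m).
have eps0 k : 0 < eps k by rewrite divr_gt0 ?exprn_gt0 ?mulr_gt0.
have /choice[V VP] k : exists VV' : (L2 mu -> L2 mu) * (L2 mu -> L2 mu),
    [/\ bounded_operator VV'.1, adjoint_of VV'.1 VV'.2 &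
        opnorm (U - VV'.1) < eps k].
  have [V AV UV] := AU _ (eps0 k); have [V' VV'] := Aadj _ AV.
  by exists (V, V'); split => //; exact: Ab.
have close k F : l2norm (U F - (V k).1 F) <= eps k * l2norm F.
  have [bV _ UV] := VP k.
  apply: le_trans (l2norm_opnorm F (bounded_opB bU bV)) _.
  by rewrite ler_wpM2r ?l2norm_ge0// ltW.
have epsG k : eps k * l2norm G <= 2^-1 ^+ k / 2.
  rewrite /eps mulrAC ler_pdivrMr ?mulr_gt0// mulrA divfK ?pnatr_eq0//.
  by rewrite ler_wpM2l ?exprn_ge0// lerDl.
have cauchy k : l2norm ((V k.+1).2 G - (V k).2 G) <= 2^-1 ^+ k.
  have [_ a1 _] := VP k; have [_ a2 _] := VP k.+1.
  have := @adjoint_norm_le ((V k.+1).1 - (V k).1) ((V k.+1).2 - (V k).2)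
    (eps k.+1 + eps k) G.
  rewrite fctE => /(_ _ _ _)/le_trans; apply.
  - by rewrite addr_ge0// ltW.
  - move=> F H; have := adjoint_of_lin (-1) a1 a2 F H.
    have -> : conjc (-1 : C) = -1.
      by apply/eqP; rewrite eq_complex /= !oppr0 !eqxx.
    by rewrite !scaleN1r !(addrC (- _)).
  - move=> F; rewrite fctE; apply: le_trans (l2norm_triangleB _ (U F) _) _.
    by rewrite mulrDl l2norm_distC lerD.
  - rewrite mulrDl; apply: le_trans (lerD (epsG _) (epsG _)) _.
    rewrite exprS; have : 0 <= (2^-1 : R) ^+ k by rewrite exprn_ge0.
    lra.
have [W WP] := riesz_fischer mufin cauchy.
exists W => F; apply/eqP; rewrite -subr_eq0; apply/eqP.
apply: ComplexField.Normc.eq0_normc; apply/eqP.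
rewrite eq_le cabs_ge0 andbT; apply/ler_addgt0Pr => e e0; rewrite add0r.
have F1 : 0 < 3 * (l2norm F + 1) by rewrite mulr_gt0// ltr_wpDl ?l2norm_ge0.
have [k ke] := half_small (divr_gt0 e0 F1).
have [_ a1 _] := VP k.
have -> : l2inner (U F) G - l2inner F W =
  l2inner (U F - (V k).1 F) G + l2inner F ((V k).2 G - W).
  by rewrite innerBl innerBr a1; ring.
apply: le_trans (le_normcD _ _) _.
rewrite ltr_pdivlMr// in ke; apply/ltW/(le_lt_trans _ ke).
apply: (@le_trans _ _ (2^-1 ^+ k / 2 * l2norm F + l2norm F * (2 * 2^-1 ^+ k))).
  apply: lerD; apply: le_trans (cauchy_schwarz _ _) _.
    apply: (@le_trans _ _ (eps k * l2norm F * l2norm G)).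
      by rewrite ler_wpM2r ?l2norm_ge0.
    by rewrite mulrAC ler_wpM2r ?l2norm_ge0.
  by rewrite ler_wpM2l ?l2norm_ge0// l2norm_distC.
have : 0 <= (2^-1 : R) ^+ k by rewrite exprn_ge0.
have := l2norm_ge0 F.
move: (2^-1 ^+ k) (l2norm F) => x y y0 x0.
have := mulr_ge0 x0 y0; nra.
Qed.

Section Compression.
Variables (k : nat) (e : 'I_k -> L2 mu) (c : R).
Hypotheses (c_neq0 : c != 0)
  (e_orth : forall i j, l2inner (e i) (e j) = (c *+ (i == j))%:C).

(** The matrix of the compression of [U] to the span of the [e i], which are
    orthogonal and all have squared norm [c]. *)
Definition compression U : 'M[C]_k :=
  \matrix_(i, j) ((c^-1)%:C * l2inner (U (e j)) (e i)).

(** Invariance of the span of the [e i] is phrased through its orthogonal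
   complement, since orthogonality survives norm limits. *)
Definition span_invariant U := forall j G,
  (forall i, l2inner (e i) G = 0) -> l2inner (U (e j)) G = 0.

Let cVc : (c^-1)%:C * c%:C = 1.
Proof. by apply/eqP; rewrite eq_complex /= mulVf// !mul0r !mulr0 subr0 addr0 !eqxx. Qed.

Lemma compression_linear a U V :
  compression (a *: U + V) = a *: compression U + compression V.
Proof.
apply/matrixP => i j; rewrite !mxE !fctE innerDl; ring.
Qed.

(** The difference of both sides is orthogonal to all the [e i], hence to
    [U (e j)] by invariance and to the sum, hence to itself. *)
Lemma span_invariantE U j : span_invariant U ->
  U (e j) = \sum_i compression U i j *: e i.
Proof.
move=> inv; set S := \sum_i _; apply/eqP; rewrite -subr_eq0; apply/eqP.
have De i : l2inner (U (e j) - S) (e i) = 0.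
  rewrite innerBl inner_suml (bigD1 i)//= big1 ?addr0; last first.
    by move=> l li; rewrite innerZl e_orth (negPf li) mulr0n mulr0.
  by rewrite innerZl e_orth eqxx mxE mulr1n mulrAC cVc mul1r subrr.
have eD i : l2inner (e i) (U (e j) - S) = 0 by rewrite innerC De conjc0.
apply: l2norm_eq0; apply/eqP; rewrite -sqrf_eq0; apply/eqP/complexI.
rewrite -inner_sqnorm innerBl inv// inner_suml big1 ?subrr// => i _.
by rewrite innerZl eD mulr0.
Qed.

Lemma compression_comp U V : bounded_operator U -> span_invariant V ->
  compression (U \o V) = compression U *m compression V.
Proof.
move=> bU inv; apply/matrixP => i j; rewrite !mxE/= span_invariantE//.
have -> : U (\sum_l compression V l j *: e l) =
    \sum_l compression V l j *: U (e l).
  have [linU _] := bU.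
  apply: (big_ind2 (fun x y => U x = y)) => [|x1 x2 y1 y2 h1 h2|l _].
  - exact: bounded0.
  - by have := linU 1 x1 y1; rewrite !scale1r h1 h2.
  - exact: boundedZ.
rewrite inner_suml mulr_sumr; apply: eq_bigr => l _.
by rewrite innerZl !mxE; ring.
Qed.

Lemma compression_adjoint U V : adjoint_of U V ->
  compression V = map_mx conjc (compression U)^T.
Proof.
move=> UV; apply/matrixP => i j; rewrite !mxE rmorphM/= oppr0; congr (_ * _).
by rewrite innerC -UV.
Qed.

Lemma compression_id : compression id = 1%:M.
Proof.
apply/matrixP => i j; rewrite !mxE e_orth eq_sym.
by case: eqP => _; rewrite ?mulr1n ?mulr0n ?cVc ?mulr0.
Qed.

(** The trace is [c^-1] times the sum of the [||U (e i)||^2]. *)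
Lemma compression_trace_ge0 U V : 0 < c -> adjoint_of U V ->
  0 <= \tr (compression (V \o U)).
Proof.
move=> c0 UV; apply: sumr_ge0 => i _; rewrite mxE.
have -> : l2inner ((V \o U) (e i)) (e i) = l2inner (U (e i)) (U (e i)).
  by rewrite [LHS]innerC -UV -innerC.
rewrite inner_sqnorm mulr_ge0// ler0c ?sqr_ge0// invr_ge0 ltW//.
Qed.

End Compression.

End Operators.

(** * Operators induced by measure preserving partial bijections *)

Section MeasureIsomorphism.
Context d (T : measurableType d) (R : realType).
Variable mu : {measure set T -> \bar R}.
Local Notation C := R[i].
Local Notation cabs := ComplexField.Normc.normc.
Implicit Types (F G H : L2 mu) (a : C).

(** The maps are total, so that they compose with functions on [T]; they encode
    mutually inverse bijections [D -> D'] and [D' -> D]. *)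
Record measure_iso (D D' : set T) (phi psi : T -> T) : Prop := MeasureIso {
  miso_dom : measurable D ;
  miso_cod : measurable D' ;
  miso_meas : measurable_fun setT phi ;
  miso_inv_meas : measurable_fun setT psi ;
  miso_fun : forall x, D x -> D' (phi x) ;
  miso_inv_fun : forall y, D' y -> D (psi y) ;
  miso_funK : forall x, D x -> psi (phi x) = x ;
  miso_invK : forall y, D' y -> phi (psi y) = y ;
  miso_mu : forall A, measurable A -> mu (D `&` phi @^-1` A) = mu (D' `&` A) }.

(** Measure preservation for [psi] is that of [phi] for the set [psi @^-1` A]. *)
Lemma measure_iso_sym D D' phi psi :
  measure_iso D D' phi psi -> measure_iso D' D psi phi.
Proof.
case=> mD mD' mp mq f g fK gK pres; split => // A mA.
have mqA : measurable (psi @^-1` A) by rewrite -[X in measurable X]setTI; exact: mq.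
rewrite -pres//; congr (mu _); apply/seteqP; split => x [Dx] /=; rewrite fK//.
Qed.

Definition pull (D : set T) (phi : T -> T) (f : T -> C) : T -> C :=
  fun x => if x \in D then f (phi x) else 0.

Lemma eq_L2 F G : {ae mu, forall x, F x = G x} -> F = G.
Proof. by move=> FG; rewrite -(L2mkK F) -(L2mkK G); apply/L2mkP. Qed.

Lemma L2lin_ae a F G : {ae mu, forall x, L2_fun (a *: F + G) x = a * F x + G x}.
Proof. by rewrite L2Dmk; exact: repr_L2mk. Qed.

Section Transfer.
Variables (D D' : set T) (phi psi : T -> T).
Hypothesis isoP : measure_iso D D' phi psi.

Let mD := miso_dom isoP.
Let mD' := miso_cod isoP.
Let mphi := miso_meas isoP.

(** [mu] on [D'] is the image under [phi] of the restriction of [mu] to [D];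
    restricting first discards the values of [phi] off [D]. *)
Lemma ge0_transfer (f : T -> \bar R) : measurable_fun setT f ->
  (forall x, 0 <= f x)%E ->
  (\int[mu]_(x in D) f (phi x) = \int[mu]_(y in D') f y)%E.
Proof.
move=> mf f0.
pose m := mrestr mu mD.
have mpD' : measurable (phi @^-1` D').
  by rewrite -[X in measurable X]setTI; exact: mphi.
have mfp : measurable_fun setT (f \o phi) by exact: measurableT_comp.
transitivity (\int[pushforward m phi]_(y in D') f y)%E; last first.
  apply: eq_measure_integral => A mA AD'.
  rewrite /= /pushforward /m /= /mrestr setIC (miso_mu isoP)//.
  by rewrite setIC (setIidl AD').
rewrite [RHS]ge0_integral_pushforward//; last exact: measurable_funTS.
rewrite [RHS](@ge0_negligible_integral _ _ _ m _ (~` D))//.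
- rewrite setDE setCK setIC (setIidl (fun x Dx => miso_fun isoP Dx)).
  apply: eq_measure_integral => A mA AD.
  by rewrite /m /= /mrestr (setIidl AD).
- exact: measurableC.
- exact: measurable_funTS.
- by move=> x _; exact: f0.
- by rewrite -[LHS]/(mu (~` D `&` D)) setIC setICr measure0.
Qed.

(** The positive and the negative part of [f] transfer separately. *)
Lemma transfer (f : T -> \bar R) : measurable_fun setT f ->
  (\int[mu]_(x in D) f (phi x) = \int[mu]_(y in D') f y)%E.
Proof.
move=> mf.
have P := @ge0_transfer _ (measurable_funepos mf) (fun x => funepos_ge0 f x).
have N := @ge0_transfer _ (measurable_funeneg mf) (fun x => funeneg_ge0 f x).
rewrite [LHS]integralE [RHS]integralE -P -N.
by rewrite -[fun x => f (phi x)]/(f \o phi) funepos_comp funeneg_comp.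
Qed.

Lemma pullE (f : T -> C) x : pull D phi f x =
  Complex ((fun y => complex.Re (f (phi y))) \_ D x)
          ((fun y => complex.Im (f (phi y))) \_ D x).
Proof. by rewrite /pull !patchE; case: ifP => // _; case: (f _). Qed.

Lemma cintegral_pull (f : T -> C) : cmeasurable f ->
  (forall y, ~ D' y -> f y = 0) ->
  Cintegral mu (pull D phi f) = Cintegral mu f.
Proof.
move=> [mr mi] f0.
have h (u : T -> R) : measurable_fun setT u -> (forall y, ~ D' y -> u y = 0) ->
    \int[mu]_x ((fun y => u (phi y)) \_ D x) = \int[mu]_x (u x) :> R.
  move=> mu_ u0; rewrite -Rintegral_mkcond.
  rewrite /Rintegral (@transfer (EFin \o u)); last exact/measurable_EFinP.
  congr fine; rewrite integral_mkcond; apply: eq_integral => y _.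
  rewrite patchE; case: ifPn => // /negP; rewrite inE => /u0 ->.
  by [].
rewrite /Cintegral; congr Complex.
  rewrite -(h (fun y => complex.Re (f y)))//; last by move=> y /f0 ->.
  by apply: eq_Rintegral => x _; rewrite pullE.
rewrite -(h (fun y => complex.Im (f y)))//; last by move=> y /f0 ->.
by apply: eq_Rintegral => x _; rewrite pullE.
Qed.

Lemma cmeasurable_pull (f : T -> C) : cmeasurable f -> cmeasurable (pull D phi f).
Proof.
move=> [mr mi].
have h (u : T -> R) : measurable_fun setT u ->
    measurable_fun setT ((fun y => u (phi y)) \_ D).
  move=> mu_; rewrite (_ : _ \_ _ = (fun x => \1_D x * u (phi x))).
    by apply: measurable_funM => //; exact: measurableT_comp.
  by apply/funext => x; rewrite patchE indicE; case: (x \in D); rewrite ?mul1r ?mul0r.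
split.
  by under eq_fun do rewrite pullE /=; exact: (h (fun y => complex.Re (f y))).
by under eq_fun do rewrite pullE /=; exact: (h (fun y => complex.Im (f y))).
Qed.

Lemma integral_pull_le (f : T -> C) : cmeasurable f ->
  (\int[mu]_x (cabs (pull D phi f x) ^+ 2)%:E <=
   \int[mu]_x (cabs (f x) ^+ 2)%:E)%E.
Proof.
move=> mf; have mf2 := measurable_cabs2 mf.
have -> : (fun x => (cabs (pull D phi f x) ^+ 2)%:E) =
    (fun x => (cabs (f (phi x)) ^+ 2)%:E) \_ D :> (T -> \bar R).
  apply/funext => x; rewrite patchE /pull; case: ifP => // _.
  by rewrite ComplexField.Normc.normc0 expr0n.
rewrite -integral_mkcond (@ge0_transfer (fun y => (cabs (f y) ^+ 2)%:E))//; last first.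
  by move=> x; rewrite lee_fin sqr_ge0.
by apply: ge0_subset_integral => // x _; rewrite lee_fin sqr_ge0.
Qed.

Lemma square_integrable_pull (f : T -> C) : square_integrable mu f ->
  square_integrable mu (pull D phi f).
Proof.
move=> sf; have mf := cmeasurable_sqint sf.
apply: square_integrable_of_integral; first exact: cmeasurable_pull.
apply: le_lt_trans (integral_pull_le mf) _.
rewrite -(@l2norm_sqr_ae _ _ _ _ (L2class mu f) f) ?ltry//.
exact: L2classE.
Qed.

(** The part in [D] of the preimage of a null set is a null set; so [pull]
    descends to classes of functions. *)
Lemma ae_pull (f g : T -> C) : {ae mu, forall x, f x = g x} ->
  {ae mu, forall x, pull D phi f x = pull D phi g x}.
Proof.
move=> [N [mN N0 fgN]]; exists (D `&` phi @^-1` N); split.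
- apply: measurableI => //.
  by rewrite -[X in measurable X]setTI; exact: mphi.
- rewrite (miso_mu isoP mN); apply/eqP; rewrite eq_le measure_ge0 andbT.
  by rewrite -N0; apply: le_measure => //; rewrite inE//; exact: measurableI.
- move=> x /= /eqP; rewrite /pull; case: ifP => [/set_mem Dx|_ /eqP//] /eqP h.
  by split => //; apply: fgN.
Qed.

Definition pull_op F : L2 mu := L2class mu (pull D phi F).

Lemma pull_op_ae F : {ae mu, forall x, pull_op F x = pull D phi F x}.
Proof. exact/L2classE/square_integrable_pull/sqint_L2. Qed.

Lemma pull_op_linear : linear pull_op.
Proof.
move=> a F G; apply: eq_L2.
apply: filterS3 (pull_op_ae (a *: F + G)) (L2lin_ae a (pull_op F) (pull_op G))
  (filterI (filterI (pull_op_ae F) (pull_op_ae G)) (ae_pull (L2lin_ae a F G))).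
move=> x -> -> [[-> ->] ->]; rewrite /pull; case: ifP => // _.
by rewrite mulr0 addr0.
Qed.

Lemma pull_op_bounded : bounded_operator pull_op.
Proof.
split; first exact: pull_op_linear.
exists 1 => F; rewrite mul1r.
rewrite -(@ler_pXn2r _ 2) ?nnegrE ?l2norm_ge0// -lee_fin.
rewrite (l2norm_sqr_ae _ (pull_op_ae F)); last first.
  exact/cmeasurable_pull/cmeasurable_L2.
by rewrite l2norm_sqr; apply: integral_pull_le; exact: cmeasurable_L2.
Qed.

End Transfer.

(** The change of variables [y = phi x] in [<F, pull psi G>], the integral of
    [F(y) conj(G(psi y))] over [D']. *)
Lemma pull_op_adjoint D D' phi psi : measure_iso D D' phi psi ->
  adjoint_of (pull_op D phi) (pull_op D' psi).
Proof.
move=> isoP F G; have isoQ := measure_iso_sym isoP.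
have mF := cmeasurable_L2 F; have mG := cmeasurable_L2 G.
have mpF := cmeasurable_pull isoP mF; have mpG := cmeasurable_pull isoQ mG.
rewrite /l2inner.
transitivity (Cintegral mu (fun x => pull D phi F x * conjc (G x))).
  apply: cintegral_ae.
  - by apply: cmeasurableM => //; exact: cmeasurable_L2.
  - exact: cmeasurableM.
  - by apply: filterS (pull_op_ae isoP F) => x ->.
transitivity (Cintegral mu (fun y => F y * conjc (pull D' psi G y))); last first.
  apply/esym/cintegral_ae.
  - by apply: cmeasurableM => //; exact: cmeasurable_L2.
  - exact: cmeasurableM.
  - by apply: filterS (pull_op_ae isoQ G) => x ->.
rewrite -[RHS](cintegral_pull isoP); last 2 first.
- exact: cmeasurableM.
- move=> y D'y; have pG0 : pull D' psi G y = 0 by rewrite /pull memNset.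
  by rewrite -[LHS]/(F y * conjc (pull D' psi G y)) pG0 conjc0 mulr0.
congr Cintegral; apply/funext => x; rewrite /pull.
case: ifPn => [/set_mem Dx|_]; last by rewrite mul0r.
by rewrite mem_set ?(miso_funK isoP)//; exact: miso_fun isoP _ Dx.
Qed.

End MeasureIsomorphism.

(** * Indicator functions *)

Section Indicators.
Context d (T : measurableType d) (R : realType).
Variable mu : {measure set T -> \bar R}.
Hypothesis mu_fin : (mu setT < +oo)%E.
Local Notation C := R[i].
Local Notation cabs := ComplexField.Normc.normc.
Implicit Types (F G H : L2 mu) (A B : set T).

Definition cindic A (x : T) : C := (\1_A x)%:C.

Definition indL2 A : L2 mu := L2class mu (cindic A).

Lemma cmeasurable_cindic A : measurable A -> cmeasurable (cindic A).
Proof. by move=> mA; split => /=; [exact: measurable_indic|exact: measurable_cst]. Qed.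

Lemma cabs_cindic A x : cabs (cindic A x) ^+ 2 = \1_A x.
Proof.
by rewrite /cindic indicE; case: (x \in A);
  rewrite /= ?expr0n/= ?expr1n addr0 ?sqrtr1 ?sqrtr0 ?expr1n ?expr0n.
Qed.

Lemma square_integrable_cindic A : measurable A ->
  square_integrable mu (cindic A).
Proof.
move=> mA; apply: square_integrable_of_integral; first exact: cmeasurable_cindic.
under eq_integral do rewrite cabs_cindic.
rewrite integral_indic// setIT; apply: le_lt_trans mu_fin.
by apply: le_measure; rewrite ?inE.
Qed.

Lemma indL2_ae A : measurable A -> {ae mu, forall x, indL2 A x = cindic A x}.
Proof. by move=> mA; exact/L2classE/square_integrable_cindic. Qed.

Lemma inner_indr G A : measurable A ->
  l2inner G (indL2 A) = Cintegral mu (fun x => G x * conjc (cindic A x)).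
Proof.
move=> mA; apply: cintegral_ae.
- by apply: cmeasurableM; exact: cmeasurable_L2.
- by apply: cmeasurableM; [exact: cmeasurable_L2|exact: cmeasurable_cindic].
- by apply: filterS (indL2_ae mA) => x ->.
Qed.

Lemma inner_indL2 A B : measurable A -> measurable B ->
  l2inner (indL2 A) (indL2 B) = (fine (mu (A `&` B)))%:C.
Proof.
move=> mA mB; rewrite inner_indr//.
transitivity (Cintegral mu (fun x => (\1_(A `&` B) x)%:C)).
  apply: cintegral_ae.
  - by apply: cmeasurableM; [exact: cmeasurable_L2|exact: cmeasurable_cindic].
  - by apply: cmeasurable_cindic; exact: measurableI.
  - apply: filterS (indL2_ae mA) => x ->.
    rewrite /cindic conjc_real !indicE in_setI -rmorphM/=.
    by case: (x \in A); case: (x \in B); rewrite ?mulr0 ?mulr1.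
rewrite /Cintegral /Rintegral/= integral_indic ?setIT//; last exact: measurableI.
by rewrite integral0.
Qed.

Lemma inner_indr_eq0 G A : measurable A -> l2inner G (indL2 A) = 0 ->
  (\int[mu]_(x in A) (complex.Re (G x))%:E = 0 /\
   \int[mu]_(x in A) (complex.Im (G x))%:E = 0)%E.
Proof.
move=> mA; rewrite inner_indr// => /eqP; rewrite eq_complex/= => /andP[/eqP r0 /eqP i0].
have [ir ii] := cintegrableM (sqint_L2 G) (square_integrable_cindic mA).
have h (u v : T -> R) : mu.-integrable setT (EFin \o u) -> \int[mu]_x u x = 0 ->
    (forall x, u x = v x * \1_A x) -> (\int[mu]_(x in A) (v x)%:E = 0)%E.
  move=> iu u0 uv; rewrite integral_mkcond.
  transitivity (\int[mu]_x (u x)%:E)%E.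
    apply: eq_integral => x _; rewrite patchE uv indicE.
    by case: (x \in A); rewrite ?mulr1 ?mulr0.
  by rewrite -[LHS]fineK ?[fine _]u0//; exact: integrable_fin_num.
split.
  apply: (h _ _ ir r0) => x; rewrite /cindic conjc_real.
  by case: (G x) => u v /=; rewrite mulr0 subr0.
apply: (h _ _ ii i0) => x; rewrite /cindic conjc_real.
by case: (G x) => u v /=; rewrite mulr0 add0r.
Qed.

Lemma integrable_L2 G :
  mu.-integrable setT (fun x => (complex.Re (G x))%:E) /\
  mu.-integrable setT (fun x => (complex.Im (G x))%:E).
Proof.
have := cintegrableM (sqint_L2 G) (square_integrable_cindic measurableT).
rewrite (_ : (fun x => _) = G) => [[]//|].
by apply/funext => x; rewrite /cindic conjc_real indicE mem_set// mulr1.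
Qed.

(** The sets over which [u] integrates to [0] are stable under complements and
    countable disjoint unions, so Dynkin's theorem applies. The disjoint cover
    [c] gives the integral over the whole space. *)
Lemma integral_eq0_pi_system (S : set (set T)) (c : nat -> set T) (u : T -> R) :
  @measurable _ T = <<s S >> -> setI_closed S ->
  (forall n, S (c n)) -> trivIset setT c -> \bigcup_n c n = setT ->
  mu.-integrable setT (fun x => (u x)%:E) ->
  (forall A, S A -> \int[mu]_(x in A) (u x)%:E = 0)%E ->
  {ae mu, forall x, u x = 0}.
Proof.
move=> gS SI Sc tc cT iu u0.
have mS A : S A -> measurable A by move=> SA; rewrite gS; exact: sub_sigma_algebra.
pose P A := (\int[mu]_(x in A) (u x)%:E = 0)%E.
have iuA A : measurable A -> mu.-integrable A (fun x => (u x)%:E).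
  by move=> mA; apply: integrableS iu.
have Pbig (F : (set T)^nat) : (forall n, measurable (F n)) -> trivIset setT F ->
    (forall n, P (F n)) -> P (\bigcup_k F k).
  move=> mF tF PF; rewrite /P integral_bigcup//; last first.
    by apply: iuA; exact: bigcupT_measurable.
  by apply: eseries0 => n _ _; exact: PF.
have PT : P setT by rewrite -cT; apply: Pbig => // n; [exact: mS|exact: u0].
have PC A : measurable A -> P A -> P (~` A).
  move=> mA PA; have := PT; rewrite /P -(setUv A) integral_setU_EFin//.
  - by rewrite PA add0e.
  - exact: measurableC.
  - by rewrite setUv; case/integrableP : iu => /measurable_EFinP.
  - exact/disj_setPCl.
have PA A : measurable A -> P A.
  by rewrite gS; apply: (dynkin_induction gS SI PT u0 PC Pbig).
have : ae_eq mu setT (fun x => (u x)%:E) (cst 0%E).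
  apply: (integral_ae_eq measurableT iu); first exact: measurable_cst.
  by move=> A _ mA; rewrite integral0; exact: PA.
by apply: filterS => x /= /(_ I) [].
Qed.

Lemma indicators_total (S : set (set T)) (c : nat -> set T) G :
  @measurable _ T = <<s S >> -> setI_closed S ->
  (forall n, S (c n)) -> trivIset setT c -> \bigcup_n c n = setT ->
  (forall A, S A -> l2inner G (indL2 A) = 0) -> G = 0.
Proof.
move=> gS SI Sc tc cT G0.
have mS A : S A -> measurable A by move=> SA; rewrite gS; exact: sub_sigma_algebra.
have [ir ii] := integrable_L2 G.
have r0 := integral_eq0_pi_system gS SI Sc tc cT ir
  (fun A SA => (inner_indr_eq0 (mS _ SA) (G0 _ SA)).1).
have i0 := integral_eq0_pi_system gS SI Sc tc cT ii
  (fun A SA => (inner_indr_eq0 (mS _ SA) (G0 _ SA)).2).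
rewrite -(L2mkK G); apply/L2mkP; apply: filterS2 r0 i0 => x.
by rewrite /L2_fun; case: (repr G x) => a b /= -> ->.
Qed.

Lemma pull_op_indL2 D D' phi psi A : measure_iso mu D D' phi psi ->
  measurable A -> pull_op D phi (indL2 A) = indL2 (D `&` phi @^-1` A).
Proof.
move=> isoP mA; apply: eq_L2.
have mB : measurable (D `&` phi @^-1` A).
  apply: measurableI; first exact: miso_dom isoP.
  by rewrite -[X in measurable X]setTI; apply: (miso_meas isoP).
apply: filterS3 (pull_op_ae isoP (indL2 A)) (indL2_ae mB)
  (ae_pull isoP (indL2_ae mA)) => x -> -> ->.
rewrite /pull /cindic !indicE in_setI.
by case: (x \in D) => //=; congr (_ %:R%:C).
Qed.

End Indicators.

(** * The infinite path space *)

Section PathSpace.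
Variable E : graph.
Implicit Types (a b : prepath E) (x y : ipath E) (v : vert E).

Lemma walk_mkseq x n : walk (irng x) (mkseq x n).
Proof.
have h m k : walk (rng (x m)) (map x (iota m k)).
  elim: k m => //= k IH m; rewrite eqxx/=.
  by rewrite -ipathP; exact: IH.
exact: h.
Qed.

Lemma fpaths_iprefix x n : fpaths E (iprefix n x).
Proof. exact: walk_mkseq. Qed.

Lemma take_mkseq x m n : (m <= n)%N -> take m (mkseq x n) = mkseq x m.
Proof. by move=> mn; rewrite /mkseq -map_take take_iota (minn_idPl mn). Qed.

Lemma ipath_ext x y : (forall n, iprefix n x = iprefix n y) -> x = y.
Proof.
move=> xy; have e : ipath_edge x = ipath_edge y.
  apply/funext => n; have := congr1 (fun a => nth (x 0%N) a.2 n) (xy n.+1).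
  by rewrite /= !nth_mkseq.
case: x y e {xy} => [x px] [y py] /= e; case: _ / e py => py.
by congr IPath; exact: Prop_irrelevance.
Qed.

Lemma cylinderE x a n : (size a.2 <= n)%N ->
  cylinder a x <-> a = (irng x, take (size a.2) (iprefix n x).2).
Proof.
by move=> an; rewrite [(iprefix n x).2]/(mkseq x n) take_mkseq.
Qed.

(** Two cylinders that meet are nested. *)
Lemma cylinder_sub a b x : cylinder a x -> cylinder b x ->
  (size a.2 <= size b.2)%N -> cylinder b `<=` cylinder a.
Proof.
move=> ax bx ab y yb; apply/(cylinderE y ab).
have e : iprefix (size b.2) y = iprefix (size b.2) x by rewrite [LHS]yb -[LHS]bx.
rewrite e; have -> : irng y = irng x by case: e.
exact/cylinderE.
Qed.

(** The empty set is added to make the family stable under intersection. *)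
Definition cylinder_system : set (set (ipath E)) :=
  [set A | A = set0 \/ exists2 a, fpaths E a & A = cylinder a].

Lemma setI_cylinder_system : setI_closed cylinder_system.
Proof.
move=> A B [->|[a pa ->]]; first by left; rewrite set0I.
move=> [->|[b pb ->]]; first by left; rewrite setI0.
have [->|/set0P[x [ax bx]]] := eqVneq (cylinder a `&` cylinder b) set0.
  by left.
right; have [ab|/ltnW ba] := leqP (size a.2) (size b.2).
  by exists b => //; rewrite setIC; apply: setIidl; exact: cylinder_sub bx ab.
by exists a => //; apply: setIidl; exact: cylinder_sub ax ba.
Qed.

Lemma open_cylinder a : fpaths E a -> open (cylinder a).
Proof.
move=> pa; exists [set cylinder a]; last by rewrite bigcup_set1.
move=> _ ->; exists [fset (cylinder a)]%fset.
  by move=> A /fset1P ->; apply/mem_set; exists a.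
by rewrite set_fset1 bigcap_set1.
Qed.

(** A basic open neighbourhood of [x] is a finite intersection of cylinders that
    contain [x]; it contains the cylinder of any prefix of [x] as long as the
    longest of their defining paths. *)
Lemma open_cover_cylinder (A : set (ipath E)) x : open A -> A x ->
  exists n, cylinder (iprefix n x) `<=` A.
Proof.
move=> [D' D'sub <-] [B D'B Bx].
have [S Ssub BE] := D'sub _ D'B.
have own n : cylinder (iprefix n x) x by rewrite /cylinder/= /plen/= size_mkseq.
have /choice[m mP] (Z : set (ipath E)) : exists m : nat,
    Z \in S -> cylinder (iprefix m x) `<=` Z.
  have [ZS|_] := boolP (Z \in S); last by exists 0%N.
  have /set_mem[a pa aZ] := Ssub _ ZS; exists (size a.2) => _.
  have ax : cylinder a x by move: Bx; rewrite -BE => /(_ Z ZS); rewrite -aZ.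
  by rewrite -aZ; apply: cylinder_sub ax (own _) _; rewrite size_mkseq.
pose n := (\max_(Z <- S) m Z)%N.
exists n => y ny; exists B => //=; rewrite -BE => Z ZS /=.
apply: (mP Z ZS); apply: (cylinder_sub (own _) (own n)) ny.
rewrite !size_mkseq /n; exact: leq_bigmax_seq.
Qed.

(** There are countably many finite paths, so an open set, which is a union of
    cylinders, is a countable union of cylinders. *)
Lemma measurable_cylinder_system :
  @measurable _ (borel_ipath E) = <<s cylinder_system >>.
Proof.
apply/seteqP; split.
- apply: smallest_sub; first exact: smallest_sigma_algebra.
  move=> A oA.
  (* the n-th finite path contributes its cylinder if it lies in A *)
  pose F (n : nat) : set (ipath E) :=
     if (choice.unpickle n : option (vert E * seq (edge E))) is Some b then
     if (b \in fpaths E) && `[< cylinder b `<=` A >] then cylinder b else set0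
     else set0.
  rewrite (_ : A = \bigcup_n F n).
    have sG : sigma_algebra setT <<s cylinder_system >>.
      exact: smallest_sigma_algebra.
    case: sG => _ _; apply => n; apply: sub_sigma_algebra.
    rewrite /F; case: choice.unpickle => [b|]; last by left.
    by case: ifPn => [/andP[/set_mem pb _]|_]; [right; exists b|left].
  apply/seteqP; split=> [x Ax|x [n _]].
    have [n nA] := open_cover_cylinder oA Ax.
    exists (choice.pickle (iprefix n x : vert E * seq (edge E))) => //.
    rewrite /F choice.pickleK.
    rewrite mem_set ?asboolT//=; last exact: fpaths_iprefix.
    by rewrite /cylinder/= /plen/= size_mkseq.
  rewrite /F; case: choice.unpickle => // b; case: ifP => // /andP[_ /asboolP].
  exact.
- apply: smallest_sub; first exact: smallest_sigma_algebra.
  move=> A [->|[a pa ->]]; first exact: measurable0.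
  by apply: sub_sigma_algebra; exact: open_cylinder.
Qed.

Lemma measurable_cylinder a : fpaths E a ->
  measurable (cylinder a : set (borel_ipath E)).
Proof. by move=> pa; apply: sub_sigma_algebra; exact: open_cylinder. Qed.

(** The vertex cylinders, indexed by [nat] as required of countable covers;
    the cells of the other indices are empty. *)
Definition vertex_cell (n : nat) : set (ipath E) :=
  [set x | choice.pickle (irng x) = n].

Lemma vertex_cellP n : cylinder_system (vertex_cell n).
Proof.
have [[v vn]|nov] := pselect (exists v : vert E, choice.pickle v = n); last first.
  by left; apply/seteqP; split => // x /= xn; apply: nov; exists (irng x).
right; exists (v, [::]) => //; apply/seteqP; split => x /=.
  by rewrite /vertex_cell/= -vn => /(pcan_inj choice.pickleK) <-.
by case=> xv; rewrite /vertex_cell/= xv.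
Qed.

Lemma trivIset_vertex_cell : trivIset setT vertex_cell.
Proof. by move=> m n _ _ [x [<- <-]]. Qed.

Lemma bigcup_vertex_cell : \bigcup_n vertex_cell n = setT.
Proof. by apply/seteqP; split => // x _; exists (choice.pickle (irng x)). Qed.

Lemma cylinder_vertex v : cylinder (v, [::]) = [set x | irng x = v].
Proof. by apply/seteqP; split => x /=; [case|move=> <-]. Qed.
End PathSpace.

(** * The groupoid action on infinite paths *)

Section GroupoidAction.
Variables (E : graph) (G : groupoid (vert E)).
Variable act : G -> prepath E -> prepath E.
Hypothesis ss : self_similar act.
Implicit Types (a b : prepath E) (x y : ipath E) (v : vert E) (g : G).

Lemma ginvK g : ginv (ginv g) = g.
Proof.
set k := ginv g; set m := ginv k.
have dm : gdom m = gdom g by rewrite /m gdom_inv /k gtgt_inv.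
have dk : gdom k = gtgt g by rewrite /k gdom_inv.
have tk : gtgt k = gdom g by rewrite /k gtgt_inv.
rewrite -[m]gmulg1 dm -(gmulVg g) -/k gmulA ?dm ?tk//.
by rewrite /m gmulVg dk gmul1g.
Qed.

Lemma act_fpaths g a : fpaths_at (gdom g) a -> fpaths_at (gtgt g) (act g a).
Proof. by move=> pa; have [[fun_g _ _] _ _] := act_piso ss g; exact: fun_g. Qed.

Lemma act_invK g a : fpaths_at (gdom g) a -> act (ginv g) (act g a) = a.
Proof.
move=> pa; rewrite -(act_mul ss) ?gdom_inv// gmulVg.
exact: act_one.
Qed.

(** The levels [k >= 1] are preserved by hypothesis, for [g] and for its inverse;
    this leaves no path of positive length for the image of a vertex. *)
Lemma act_plen g a : fpaths_at (gdom g) a -> plen (act g a) = plen a.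
Proof.
have pos h b : fpaths_at (gdom h) b -> (1 <= plen b)%N -> plen (act h b) = plen b.
  move=> pb b1; have [_ lev _] := act_piso ss h.
  have [fun_h _ _] := lev _ b1.
  by have [] := fun_h b (conj pb erefl).
move=> pa; have [a0|] := posnP (plen a); last exact: pos.
have [ga0|ga1] := posnP (plen (act g a)); first by rewrite a0.
have := pos (ginv g) (act g a); rewrite gdom_inv act_invK// => -> //.
exact: act_fpaths.
Qed.

Lemma act_iprefixS g x n : irng x = gdom g ->
  exists2 f, rng f = psrc (act g (iprefix n x)) &
    act g (iprefix n.+1 x) = pcat (act g (iprefix n x)) (edge_path f).
Proof.
move=> xg; have [_ _ ext] := act_piso ss g.
have -> : iprefix n.+1 x = pcat (iprefix n x) (edge_path (x n)).
  by rewrite /iprefix /pcat/= mkseqS cats1.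
apply: ext; first by split => //; exact: fpaths_iprefix.
rewrite /psrc/=; case: n => [//|n].
by rewrite mkseqS map_rcons last_rcons ipathP.
Qed.

(** As [g] extends paths edge by edge, the last edges of the images of the
    prefixes of [x] form an infinite path. *)
Lemma iact_exists g x : irng x = gdom g ->
  exists y, forall n, act g (iprefix n x) = iprefix n y.
Proof.
move=> xg.
pose y n := last (x 0%N) (act g (iprefix n.+1 x)).2.
have step n : act g (iprefix n x) = (gtgt g, mkseq y n).
  elim: n => [|n IH].
    have p0 : fpaths_at (gdom g) (iprefix 0 x) by [].
    have := act_plen p0; have [_] := act_fpaths p0.
    by case: (act g (iprefix 0 x)) => r [|//] /= ->.
  have [f _ e] := act_iprefixS n xg.
  have yn : y n = f by rewrite /y e /= cats1 last_rcons.
  by rewrite e IH /pcat /= cats1 mkseqS yn.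
have yP n : rng (y n) = psrc (act g (iprefix n x)).
  by have [f ef e] := act_iprefixS n xg; rewrite /y e /= cats1 last_rcons.
have yE n : rng (y n.+1) = src (y n).
  by rewrite yP step mkseqS /psrc/= map_rcons last_rcons.
exists (IPath yE) => n; rewrite step /iprefix /irng/= yP step.
by [].
Qed.

Lemma iactP g x n : irng x = gdom g ->
  act g (iprefix n x) = iprefix n (iact act g x).
Proof.
move=> xg; rewrite /iact; case: xgetP => [y _ [_ //]|none].
by have [y yP] := iact_exists xg; have := none y; case.
Qed.

Lemma iact_out g x : irng x <> gdom g -> iact act g x = x.
Proof. by move=> xg; rewrite /iact; case: xgetP => // y _ []. Qed.

Lemma irng_iact g x : irng x = gdom g -> irng (iact act g x) = gtgt g.
Proof.
move=> xg; have p0 : fpaths_at (gdom g) (iprefix 0 x) by [].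
by have [_] := act_fpaths p0; rewrite iactP.
Qed.

Lemma iactK g x : irng x = gdom g -> iact act (ginv g) (iact act g x) = x.
Proof.
move=> xg; apply: ipath_ext => n.
rewrite -iactP ?gdom_inv ?irng_iact// -iactP// act_invK//.
by split => //; exact: fpaths_iprefix.
Qed.

Lemma iactVK g x : irng x = gtgt g -> iact act g (iact act (ginv g) x) = x.
Proof. by move=> xg; rewrite -[g in iact act g]ginvK iactK// gdom_inv. Qed.

Lemma cylinder_iact g a x : fpaths_at (gdom g) a -> irng x = gdom g ->
  cylinder (act g a) (iact act g x) <-> cylinder a x.
Proof.
move=> pa xg; rewrite /cylinder/= act_plen// -iactP//; split=> [|->//].
move=> /(congr1 (act (ginv g))); rewrite !act_invK//.
by split => //; exact: fpaths_iprefix.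
Qed.

Lemma cylinder_irng a x : cylinder a x -> irng x = prng a.
Proof. by move=> <-. Qed.

(** On its domain, [g] is a bijection between cylinders of the same level. *)
Lemma preimage_iact_cylinder g a : fpaths E a ->
  [set x | irng x = gdom g] `&` iact act g @^-1` cylinder a =
  if prng a == gtgt g then cylinder (act (ginv g) a) else set0.
Proof.
move=> pa; case: eqP => [ag|nag]; last first.
  apply/seteqP; split => // x [/= xg /cylinder_irng].
  by rewrite irng_iact// => /esym.
have pa' : fpaths_at (gdom (ginv g)) a by rewrite gdom_inv.
apply/seteqP; split => x /=.
  move=> [xg ax]; rewrite -(iactK xg); apply/cylinder_iact => //.
  by rewrite gdom_inv irng_iact.
move=> ax; have xg : irng x = gdom g.
  by rewrite (cylinder_irng ax); have [_ ->] := act_fpaths pa'; rewrite gtgt_inv.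
split => //; apply/(cylinder_iact pa'); first by rewrite gdom_inv irng_iact.
by rewrite iactK.
Qed.

Lemma measurable_irng v : measurable ([set x | irng x = v] : set (borel_ipath E)).
Proof. by rewrite -cylinder_vertex; exact: measurable_cylinder. Qed.

(** Off its domain, [iact act g] is the identity. *)
Lemma measurable_iact g :
  measurable_fun setT (iact act g : borel_ipath E -> borel_ipath E).
Proof.
apply: (@measurability _ _ (borel_ipath E) (borel_ipath E) setT (iact act g)
  _ (measurable_cylinder_system E)) => _ [A SA <-].
rewrite setTI.
pose D : set (borel_ipath E) := [set x | irng x = gdom g].
have mD : measurable D by exact: measurable_irng.
have -> : iact act g @^-1` A = (D `&` iact act g @^-1` A) `|` (~` D `&` A).
  apply/seteqP; split => x /=.
    have [Dx|nDx] := pselect (D x); first by left.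
    by rewrite iact_out//; right.
  by move=> [[]//|[nDx]]; rewrite iact_out.
case: SA => [->|[a pa ->]]; first by rewrite preimage_set0 !setI0 setU0.
apply: measurableU.
  rewrite preimage_iact_cylinder//; case: eqP => // ag.
  apply: measurable_cylinder.
  by have [] : fpaths_at (gtgt (ginv g)) (act (ginv g) a)
    by apply: act_fpaths; rewrite gdom_inv.
by apply: measurableI; [exact: measurableC|exact: measurable_cylinder].
Qed.

Section Koopman.
Variables (R : realType) (p : nat) (nu : probability (borel_ipath E) R).
Hypothesis unif : uniform_measure p nu.
Local Notation C := R[i].

Lemma nu_finite : (nu setT < +oo)%E.
Proof. by rewrite probability_setT ltry. Qed.

(** Both sides are finite measures of [A]. They agree on cylinders, because the
    measure of a cylinder depends on its level alone. *)
Lemma iact_preserves g (A : set (borel_ipath E)) : measurable A ->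
  nu ([set x | irng x = gdom g] `&` iact act g @^-1` A) =
  nu ([set x | irng x = gtgt g] `&` A).
Proof.
move=> mA; have mphi := measurable_iact g.
pose m1_ : {measure set (borel_ipath E) -> \bar R} :=
  pushforward (mrestr nu (measurable_irng (gdom g)))
    (iact act g : borel_ipath E -> borel_ipath E).
pose m1 := m1_ mphi.
pose m2 : {measure set (borel_ipath E) -> \bar R} :=
  mrestr nu (measurable_irng (gtgt g)).
rewrite setIC [in RHS]setIC -[LHS]/(m1 A) -[RHS]/(m2 A).
apply: (@measure_unique _ _ (borel_ipath E) (cylinder_system (E := E))
  (vertex_cell (E := E)) _ _ _ _ m1 m2) => //.
- exact: measurable_cylinder_system.
- exact: setI_cylinder_system.
- exact: vertex_cellP.
- exact: bigcup_vertex_cell.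
- move=> B [->|[a pa ->]]; first by rewrite !measure0.
  rewrite -[LHS]/(nu (iact act g @^-1` cylinder a `&` [set x | irng x = gdom g])).
  rewrite -[RHS]/(nu (cylinder a `&` [set x | irng x = gtgt g])).
  rewrite setIC preimage_iact_cylinder//; case: eqP => ag; last first.
    rewrite measure0 (_ : _ `&` _ = set0) ?measure0//.
    by apply/seteqP; split => // x [/cylinder_irng/= -> ].
  rewrite setIidl; last by move=> x /cylinder_irng /= ->.
  have pa' : fpaths_at (gdom (ginv g)) a by rewrite gdom_inv.
  have [pga _] := act_fpaths pa'.
  transitivity (((#|vert E| * p ^ plen a)%:R^-1)%:E : \bar R).
    by apply: unif; split => //; exact: act_plen.
  by apply/esym/unif; split.
- move=> n; have mc : measurable (vertex_cell n : set (borel_ipath E)).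
    rewrite measurable_cylinder_system; apply: sub_sigma_algebra.
    exact: vertex_cellP.
  apply: le_lt_trans (ltry 1); apply: probability_le1.
  apply: measurableI; last exact: measurable_irng.
  by rewrite -[X in measurable X]setTI; exact: measurable_iact.
Qed.

Lemma iact_measure_iso g : measure_iso nu
  [set x | irng x = gdom g] [set x | irng x = gtgt g]
  (iact act g) (iact act (ginv g)).
Proof.
split.
- exact: measurable_irng.
- exact: measurable_irng.
- exact: measurable_iact.
- exact: measurable_iact.
- by move=> x; exact: irng_iact.
- by move=> x xg; rewrite /= irng_iact ?gtgt_inv// gdom_inv.
- by move=> x; exact: iactK.
- by move=> x; exact: iactVK.
- by move=> A; exact: iact_preserves.
Qed.

Lemma koopmanE g : koopman act nu g =
  pull_op ([set x | irng x = gtgt g] : set (borel_ipath E)) (iact act (ginv g)).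
Proof.
apply/funext => F; congr L2class; apply/funext => x; rewrite /pull.
by congr (if _ then _ else _); apply/eqP/idP; rewrite inE.
Qed.

End Koopman.
End GroupoidAction.

(** * The Koopman algebra *)

Section Levels.
Variable E : graph.

Definition level (n : nat) : {set vert E * n.-tuple (edge E)} :=
  [set t : vert E * n.-tuple (edge E) | walk t.1 t.2]%SET.

Definition level_path n (i : 'I_#|level n|) : prepath E :=
  ((enum_val i).1, tval (enum_val i).2).

Lemma level_pathP n (i : 'I_#|level n|) : fpaths_len E n (level_path i).
Proof.
split; last by rewrite /plen /= size_tuple.
by have := enum_valP i; rewrite inE.
Qed.

Lemma level_path_inj n : injective (@level_path n).
Proof.
move=> i j [e1 e2]; apply: enum_val_inj.
by move: e1 e2; case: (enum_val i) (enum_val j) => [v t] [w u] /= -> /val_inj ->.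
Qed.

Lemma level_path_surj n a : fpaths_len E n a -> exists i, @level_path n i = a.
Proof.
case: a => v l [/= wl ln].
have sl : size l == n by apply/eqP.
have lev : (v, Tuple sl) \in level n by rewrite inE.
exists (enum_rank_in lev (v, Tuple sl)).
by rewrite /level_path enum_rankK_in.
Qed.

Lemma level_gt0 n : (0 < #|level n|)%N.
Proof.
have [i _] : exists i, @level_path n i = iprefix n (point : ipath E).
  apply: level_path_surj; split; first exact: fpaths_iprefix.
  by rewrite /plen size_mkseq.
exact: leq_ltn_trans (leq0n i) (ltn_ord i).
Qed.

Lemma cylinder_disjoint n a b : fpaths_len E n a -> fpaths_len E n b ->
  a <> b -> cylinder a `&` cylinder b = set0.
Proof.
move=> [_ an] [_ bn] ab; apply/seteqP; split => // x [ax bx]; apply: ab.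
by rewrite -ax -bx an bn.
Qed.

End Levels.

Section KoopmanAlgebra.
Variables (R : realType) (E : graph) (G : groupoid (vert E)).
Variables (act : G -> prepath E -> prepath E) (p : nat).
Variable nu : probability (borel_ipath E) R.
Hypotheses (ss : self_similar act) (p_gt0 : (0 < p)%N)
  (unif : uniform_measure p nu).
Local Notation C := R[i].
Local Notation ind a := (indL2 nu (cylinder a : set (borel_ipath E))).

Let nu_fin : (nu setT < +oo)%E := nu_finite nu.

Definition level_mass n : R := (#|vert E| * p ^ n)%:R^-1.

Definition level_basis n (i : 'I_#|level E n|) : L2 nu := ind (level_path i).

Lemma level_mass_gt0 n : 0 < level_mass n.
Proof.
by rewrite invr_gt0 ltr0n muln_gt0 vert_nonempty expn_gt0 p_gt0.
Qed.

Lemma level_basis_orth n (i j : 'I_#|level E n|) :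
  l2inner (level_basis i) (level_basis j) = (level_mass n *+ (i == j))%:C.
Proof.
have [pi _] := level_pathP i; have [pj _] := level_pathP j.
rewrite inner_indL2//; try exact: measurable_cylinder.
case: eqP => [<-|ij].
  rewrite setIid mulr1n; congr (_%:C).
  exact: (congr1 fine (unif (level_pathP i))).
rewrite (cylinder_disjoint (level_pathP i) (level_pathP j)) ?measure0//.
by move/level_path_inj.
Qed.

Lemma indL2_set0 : indL2 nu (set0 : set (borel_ipath E)) = 0.
Proof.
apply: l2norm_eq0; apply/eqP; rewrite -sqrf_eq0; apply/eqP/complexI.
by rewrite -inner_sqnorm inner_indL2// set0I measure0.
Qed.

Lemma koopman_ind g a : fpaths E a ->
  koopman act nu g (ind a) = if prng a == gdom g then ind (act g a) else 0.
Proof.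
move=> pa; have iso := measure_iso_sym (iact_measure_iso ss unif g).
rewrite koopmanE (pull_op_indL2 nu_fin iso (measurable_cylinder pa)).
have := preimage_iact_cylinder ss (ginv g) pa.
rewrite gdom_inv gtgt_inv ginvK => ->.
by case: ifP => // _; exact: indL2_set0.
Qed.

Lemma koopman_bounded g : bounded_operator (koopman act nu g).
Proof.
rewrite koopmanE; apply: pull_op_bounded.
exact: (measure_iso_sym (iact_measure_iso ss unif g)).
Qed.

Lemma koopman_adjoint g :
  adjoint_of (koopman act nu g) (koopman act nu (ginv g)).
Proof.
rewrite !koopmanE ginvK; apply: pull_op_adjoint.
rewrite gtgt_inv.
exact: (measure_iso_sym (iact_measure_iso ss unif g)).
Qed.

(** [g] either sends a basis vector to one of the same level or kills it. *)
Lemma koopman_span_invariant g n :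
  span_invariant (@level_basis n) (koopman act nu g).
Proof.
move=> j H He; have [pj lj] := level_pathP j.
rewrite koopman_ind//; case: eqP => [jg|_]; last exact: inner0l.
have pj' : fpaths_at (gdom g) (level_path j) by [].
have [i <-] : exists i, @level_path E n i = act g (level_path j).
  apply: level_path_surj; split; last by rewrite (act_plen ss).
  by have [] := act_fpaths ss pj'.
exact: He.
Qed.

(** The properties of [kappa_g] that survive linear combinations and norm
    limits, and on which the representations rely. *)
Definition graded (U : L2 nu -> L2 nu) : Prop :=
  [/\ bounded_operator U, exists V, adjoint_of U V &
      forall n, span_invariant (@level_basis n) U].

Lemma graded_koopman_alg (f : G -> C) : finite_set [set g | f g != 0] ->
  graded (koopman_alg act nu f).
Proof.
move=> fin; rewrite /koopman_alg fsbig_finite//=.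
apply: (big_ind graded) => [|U V [bU [U' UU'] iU] [bV [V' VV'] iV]|g _].
- split; first exact: bounded_op0.
  + by exists 0; exact: adjoint_of0.
  + by move=> n j H _; exact: inner0l.
- split.
  + by rewrite -[U]scale1r; exact: bounded_op_lin.
  + exists (conjc 1 *: U' + V').
    by rewrite -[X in adjoint_of (X + _)]scale1r; exact: adjoint_of_lin.
  + by move=> n j H He; rewrite fctE innerDll iU// iV// addr0.
- split.
  + by rewrite -[X in bounded_operator X]addr0; apply: bounded_op_lin;
      [exact: koopman_bounded|exact: bounded_op0].
  + exists (conjc (f g) *: koopman act nu (ginv g) + 0).
    rewrite -[X in adjoint_of X _]addr0; apply: adjoint_of_lin.
      exact: koopman_adjoint.
    exact: adjoint_of0.
  + move=> n j H He; rewrite fctE innerZl.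
    by rewrite koopman_span_invariant// mulr0.
Qed.

Lemma graded_koopman_Cstar U : koopman_Cstar act nu U -> graded U.
Proof.
move=> AU.
have gr V : [set koopman_alg act nu f | f in
    [set f | finite_set [set g | f g != 0]]] V -> graded V.
  by move=> [f fin <-]; exact: graded_koopman_alg.
split.
- by case: AU.
- by apply: norm_closure_adjointable AU _ _ => // V /gr[].
- move=> n j H He; apply: (norm_closure_inner0 AU) => V /gr[//] _ _ iV.
  exact: iV.
Qed.

(** Adjointable operators are determined by their values on the indicators of
    cylinders: the adjoints have the same inner products with these indicators,
    which are total. *)
Lemma adjointable_ext U V U' V' : adjoint_of U U' -> adjoint_of V V' ->
  (forall n i, U (@level_basis n i) = V (level_basis i)) -> U = V.
Proof.
move=> UU' VV' UV.
have U'V' F : U' F = V' F.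
  apply/eqP; rewrite -subr_eq0; apply/eqP.
  apply: (@indicators_total _ _ _ nu nu_fin (cylinder_system (E := E))
    (vertex_cell (E := E))).
  - exact: measurable_cylinder_system.
  - exact: setI_cylinder_system.
  - exact: vertex_cellP.
  - exact: trivIset_vertex_cell.
  - exact: bigcup_vertex_cell.
  - move=> A [->|[a pa ->]]; first by rewrite indL2_set0 inner0r.
    have [i ia] : exists i, @level_path E (plen a) i = a by exact: level_path_surj.
    rewrite -ia -/(level_basis i) innerC innerBr -UU' -VV' UV subrr.
    exact: conjc0.
apply/funext => F; apply: inner_ext => H.
by rewrite innerC UU' U'V' -VV' -innerC.
Qed.

Definition unit_indicator (g : G) : C := (g == gone G (gdom g))%:R.

Lemma unit_indicator_neq0 g : (unit_indicator g != 0) = (g == gone G (gdom g)).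
Proof. by rewrite /unit_indicator pnatr_eq0 eqb0 negbK. Qed.

Lemma finite_unit_indicator : finite_set [set g | unit_indicator g != 0].
Proof.
apply: (@sub_finite_set _ _ (gone G @` setT)).
  by move=> g /=; rewrite unit_indicator_neq0 => /eqP ->; exists (gdom g).
by apply: finite_image; exact: finite_finset.
Qed.

(** On the indicator of [Z(a)], the only unit of [G] that contributes is the one
    at the range of [a], and it acts trivially. *)
Lemma koopman_alg_unit : koopman_alg act nu unit_indicator = id.
Proof.
have [_ [U' UU'] _] := graded_koopman_alg finite_unit_indicator.
apply: (adjointable_ext UU' (V' := id)) => // n i.
have [pi li] := level_pathP i; set u := prng (level_path i).
have pu : fpaths_at u (level_path i) by [].
rewrite /koopman_alg fsbig_finite/=; last exact: finite_unit_indicator.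
rewrite (big_morph (fun U : L2 nu -> L2 nu => U (level_basis i))
  (op1 := +%R) (id1 := 0))//.
have uin : gone G u \in fset_set [set g | unit_indicator g != 0].
  rewrite in_fset_set; last exact: finite_unit_indicator.
  rewrite mem_set//=.
  by rewrite unit_indicator_neq0 gdom_one.
rewrite (bigD1_seq (gone G u))//= big_seq_cond big1 ?addr0; last first.
  move=> g /andP[]; rewrite in_fset_set; last exact: finite_unit_indicator.
  move=> /set_mem/=; rewrite unit_indicator_neq0 => /eqP gE gu.
  rewrite fctE koopman_ind// ifF ?scaler0//.
  by apply/negP => /eqP ug; move: gu; rewrite gE -ug eqxx.
rewrite fctE koopman_ind// gdom_one eqxx (act_one ss)//.
by rewrite /unit_indicator gdom_one eqxx scale1r.
Qed.

Lemma koopman_Cstar_unit : is_unit_of (koopman_Cstar act nu) id.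
Proof.
split=> //; split.
  split=> //; exists 1 => F; by rewrite mul1r.
move=> e e0; exists id.
  exists unit_indicator; first exact: finite_unit_indicator.
  exact: koopman_alg_unit.
rewrite (_ : opnorm _ = 0)// /opnorm (_ : [set _ | _ in _] = [set 0]) ?sup1//.
apply/seteqP; split => x /=.
  by move=> [F _ <-]; rewrite !fctE subrr l2norm0.
by move=> ->; exists 0; rewrite ?l2norm0 ?ler01// !fctE subrr l2norm0.
Qed.

Definition level_rep n (U : L2 nu -> L2 nu) : 'M[C]_#|level E n| :=
  compression (@level_basis n) (level_mass n) U.

Lemma level_mass_neq0 n : level_mass n != 0.
Proof. exact/lt0r_neq0/level_mass_gt0. Qed.

Lemma level_rep_star_hom n : star_hom (koopman_Cstar act nu) (level_rep n).
Proof.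
have orth := @level_basis_orth n.
split.
- by move=> a U V _ _; exact: compression_linear.
- move=> U V /graded_koopman_Cstar[bU _ _] /graded_koopman_Cstar[_ _ iV].
  by rewrite /level_rep (compression_comp (level_mass_neq0 n) orth bU (iV n)).
- move=> U /graded_koopman_Cstar[bU aU _].
  exact: (compression_adjoint (@level_basis n) (level_mass n) (adjoint_ofP bU aU)).
Qed.

Lemma koopman_Cstar_rfd : residually_finite_dimensional (koopman_Cstar act nu).
Proof.
exists (fun n => #|level E n|), level_rep; split.
- exact: level_gt0.
- exact: level_rep_star_hom.
- move=> U V /graded_koopman_Cstar[_ [U' UU'] iU].
  move=> /graded_koopman_Cstar[_ [V' VV'] iV] UV.
  apply: adjointable_ext UU' VV' _ => n i.
  have orth := @level_basis_orth n.
  rewrite (span_invariantE (level_mass_neq0 n) orth i (iU n)).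
  rewrite (span_invariantE (level_mass_neq0 n) orth i (iV n)).
  by have := UV n; rewrite /level_rep => ->.
Qed.

Definition level_trace n (U : L2 nu -> L2 nu) : C :=
  #|level E n|%:R^-1 * \tr (level_rep n U).

Lemma level_trace_normalized n :
  normalized_trace (koopman_Cstar act nu) (level_trace n).
Proof.
have orth := @level_basis_orth n; have [lin mul _] := level_rep_star_hom n.
split; first split.
- move=> a U V AU AV; rewrite /level_trace lin// mxtraceD mxtraceZ; ring.
- move=> U /graded_koopman_Cstar[bU aU _].
  apply: mulr_ge0; first by rewrite invr_ge0 ler0n.
  exact: (compression_trace_ge0 (@level_basis n) (level_mass_gt0 n) (adjoint_ofP bU aU)).
- move=> U V AU AV; rewrite /level_trace (mul U V AU AV) (mul V U AV AU).
  by congr (_ * _); exact: mxtrace_mulC.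
exists id; first exact: koopman_Cstar_unit.
rewrite /level_trace /level_rep (compression_id (level_mass_neq0 n) orth).
by rewrite mxtrace1 mulVf// pnatr_eq0 -lt0n level_gt0.
Qed.

End KoopmanAlgebra.

Theorem theorem4p2 (R : realType) (E : graph) (G : groupoid (vert E))
    (act : G -> prepath E -> prepath E) (p : nat)
    (nu : probability (borel_ipath E) R) :
  self_similar act ->
  level_transitive act ->
  (2 <= p)%N ->
  (forall u : vert E, #|[set e : edge E | rng e == u]%SET| = p) ->
  uniform_measure p nu ->
  residually_finite_dimensional (koopman_Cstar act nu) /\
  exists tau0, normalized_trace (koopman_Cstar act nu) tau0.
Proof.
move=> ss _ p2 _ unif; have p0 : (0 < p)%N by exact: ltnW.
split; first exact: koopman_Cstar_rfd ss p0 unif.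
by exists (level_trace p 0); exact: level_trace_normalized ss p0 unif 0%N.
Qed.
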